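(* Let $e\in\mathbb{N}$, let $G$ be a divisor on the Hirzebruch surface $\mathcal{H}_e$ over $\mathbb{F}_q$, and write $G+(f)=aS_e+bF_e$ with $f\in\mathbb{F}_q(\mathcal{H}_e)\setminus\{0\}$ and $(a,b)\in\mathbb{Z}^2$. Then the Riemann–Roch space of $G$ is $$L(G)=\left(\frac{f}{X_1^{a}T_1^{b}}\right)L_*(aS_e+bF_e),$$ where $$L_*(aS_e+bF_e)=\sum_{d_1=0}^{a}\Big[\langle X_1^{d_1}X_2^{a-d_1}\rangle\otimes\mathbb{F}_q[T_1,T_2]^h_{b-ea+ed_1}\Big].$$
   Context: $q$ is a prime power and $\mathbb{F}_q$ the field with $q$ elements. The Hirzebruch surface $\mathcal{H}_e$ over $\mathbb{F}_q$ is the quotient of $(\mathbb{A}^2\setminus\{0\})\times(\mathbb{A}^2\setminus\{0\})$, with coordinates $(X_1,X_2)$ and $(T_1,T_2)$, by the action of $\mathbb{G}_m^2$ given by $(\lambda,\mu)\cdot(x_1,x_2,t_1,t_2)=(\lambda\mu^{-e}x_1,\lambda x_2,\mu t_1,\mu t_2)$. Thus $T_1,T_2$ have bidegree $(0,1)$, $X_1$ has bidegree $(1,-e)$, $X_2$ has bidegree $(1,0)$, and the function field $\mathbb{F}_q(\mathcal{H}_e)$ consists of $0$ and the quotients of nonzero bihomogeneous polynomials of equal bidegree. The prime divisors $S_e=\{X_1=0\}$ and $F_e=\{T_1=0\}$ generate $\mathrm{Pic}(\mathcal{H}_e)\cong\mathbb{Z}^2$, with $F_e^2=0$, $F_e\cdot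 S_e=1$, $S_e^2=-e$. $(f)$ denotes the principal divisor of $f$, and $L(D)=\{h\in\mathbb{F}_q(\mathcal{H}_e)\setminus\{0\}\mid (h)\ge -D\}\cup\{0\}$. $\mathbb{F}_q[T_1,T_2]^h_k$ is the space of homogeneous polynomials of degree $k$ (and $0$), equal to $\{0\}$ if $k<0$; the tensor product is identified with the product inside $\mathbb{F}_q[X_1,X_2,T_1,T_2]$, so $L_*(aS_e+bF_e)$ is the span of the monomials $X_1^{d_1}X_2^{d_2}T_1^{c_1}T_2^{c_2}$ with nonnegative exponents satisfying $d_1+d_2=a$, $c_1+c_2-ed_1=b-ea$ (zero if there are none). For a rational fraction $g$ and a space $V$, $gV=\{gv\mid v\in V\}$. *)

(* Defs.v *)
From HB Require Import structures.
From mathcomp Require Import all_boot all_order all_algebra.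
From mathcomp Require Import ring fraction mpoly.
From mathcomp Require Import boolp classical_sets cardinality.

Set Implicit Arguments.
Unset Strict Implicit.
Unset Printing Implicit Defensive.

Import Order.TTheory GRing.Theory Num.Theory.

Local Open Scope ring_scope.
Local Open Scope classical_set_scope.

(* Ideals, localizations and orders of vanishing, for a subring [A] of a field
   [K] given as a set of elements of [K]. *)
Section LocalAlgebra.
Variable K : fieldType.
Implicit Types (A I J O : set K).

Record prime_ideal A I : Prop := PrimeIdeal {
  prime_ideal_sub : I `<=` A;
  prime_ideal0 : I 0;
  prime_idealD : forall x y, I x -> I y -> I (x + y);
  prime_idealMl : forall x y, A x -> I y -> I (x * y);
  prime_ideal1 : ~ I 1;
  prime_idealP : forall x y, A x -> A y -> I (x * y) -> I x \/ I y
}.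

(* [A] is a domain, so height one means that 0 is the only prime ideal properly
   contained in [I]. *)
Definition height_one_prime A I : Prop :=
  [/\ prime_ideal A I, I <> [set 0] &
      forall J, prime_ideal A J -> J `<=` I -> J = [set 0] \/ J = I].

Definition localization A I : set K :=
  [set z | exists x y, [/\ A x, A y, ~ I y & z = x / y]].

Definition unit_in O (x : K) : Prop := [/\ x != 0, O x & O x^-1].

(* [p] generates the ideal of nonunits of [O]. *)
Definition uniformizer O (p : K) : Prop :=
  [/\ p != 0, O p, ~ unit_in O p &
      forall x, O x -> ~ unit_in O x -> O (x / p)].

(* The valuation of a nonzero [x] for a discrete valuation ring [O] with
   fraction field containing [x]: the integer n such that x = p ^ n * u with
   [p] a uniformizer and [u] a unit.  It is a dummy value if [x = 0]. *)
Definition val_in O (x : K) : int :=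
  xget 0 [set n : int | exists2 p, uniformizer O p & unit_in O (x / p ^ n)].

Lemma frac_eq1 (x q b c d : K) : b != 0 -> c != 0 -> d != 0 ->
  x * q / b = q * c / (b * d) * (x * d / c).
Proof. by move=> b0 c0 d0; field; rewrite b0 c0 d0. Qed.

Lemma frac_eqX (x q b c d : K) k : b != 0 -> c != 0 -> d != 0 ->
  x ^+ k * q / b = (x * d / c) ^+ k * (q * c ^+ k / (b * d ^+ k)).
Proof.
move=> b0 c0 d0; rewrite expr_div_n exprMn.
by field; rewrite b0 !expf_neq0.
Qed.

End LocalAlgebra.

Section Hirzebruch.
Variables (F : finFieldType) (e : nat).

(* The Cox ring F[X_1, X_2, T_1, T_2].  Indices are shifted by one:
   [xvar ord0], [xvar ord_max], [tvar ord0], [tvar ord_max] index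
   X_1, X_2, T_1, T_2. *)
Notation cox := {mpoly F[2 + 2]}.
Notation fcox := {fraction cox}.

Definition xvar (i : 'I_2) : 'I_(2 + 2) := lshift 2 i.
Definition tvar (j : 'I_2) : 'I_(2 + 2) := rshift 2 j.

Definition bideg (m : 'X_{1..2 + 2}) : int * int :=
  ((m (xvar ord0) + m (xvar ord_max))%:Z,
   (m (tvar ord0) + m (tvar ord_max))%:Z - (e * m (xvar ord0))%:Z).

(* The zero polynomial is bihomogeneous of every bidegree. *)
Definition bihomog (d : int * int) (p : cox) : Prop :=
  forall m, m \in msupp p -> bideg m = d.

Definition function_field : set fcox :=
  [set h | exists d (A B : cox),
     [/\ bihomog d A, bihomog d B, B != 0 & h = tofrac A / tofrac B]].

Definition chart_mon (i j : 'I_2) (n m : nat) : 'X_{1..2 + 2} :=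
  (U_(xvar i) *+ n + U_(tvar j) *+ m)%MM.

(* The surface is covered by the affine open sets U_ij = {X_i <> 0, T_j <> 0};
   the coordinate ring of U_ij consists of the invariants of the localization
   of the Cox ring at X_i T_j, i.e. of its elements of bidegree (0, 0). *)
Definition chart_ring (i j : 'I_2) : set fcox :=
  [set h | exists n m (A : cox),
     bihomog (bideg (chart_mon i j n m)) A
     /\ h = tofrac A / tofrac 'X_[chart_mon i j n m]].

(* The ideal of the functions on U_ij vanishing on {X_v = 0}, for a variable
   X_v of the Cox ring. *)
Definition chart_ideal (i j : 'I_2) (v : 'I_(2 + 2)) : set fcox :=
  [set h | exists n m (A : cox),
     bihomog (bideg (chart_mon i j n m)) ('X_v * A)
     /\ h = tofrac ('X_v * A) / tofrac 'X_[chart_mon i j n m]].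

(* A prime divisor is given by its generic point, which is a height one prime
   of the coordinate ring of any chart meeting it.  As the surface is
   separated, that point is determined by its local ring, a subring of the
   function field, and this identifies the points seen in different charts. *)
Record prime_divisor := PrimeDivisor {
  local_ring : set fcox;
  local_ringP : exists i j I,
    height_one_prime (chart_ring i j) I
    /\ local_ring = localization (chart_ring i j) I
}.

Record divisor := Divisor {
  coeff :> prime_divisor -> int;
  coeff_finite : finite_set [set P | coeff P != 0]
}.

(* The coefficients of the principal divisor (h), for [h] nonzero. *)
Definition principal_coeff (h : fcox) (P : prime_divisor) : int := val_in (local_ring P) h.

(* The coefficients of the prime divisor [Q], as a divisor. *)
Definition prime_coeff (Q P : prime_divisor) : int := `[< P = Q >]%:R.

Definition riemann_roch (D : divisor) : set fcox :=
  [set h | h = 0 \/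
     [/\ function_field h, h != 0 & forall P, - D P <= principal_coeff h P]].

(* F[T_1, T_2]^h_k *)
Definition homogT (k : int) (p : cox) : Prop :=
  forall m, m \in msupp p ->
    [/\ m (xvar ord0) = 0%N, m (xvar ord_max) = 0%N & (mdeg m)%:Z = k].

(* L_*(a S_e + b F_e), as a space of polynomials; the sum is empty if a < 0. *)
Definition Lstar (a b : int) : set cox :=
  match a with
  | Posz n =>
      [set s | exists c : nat -> cox,
        (forall d, (d <= n)%N ->
           homogT (b - e%:Z * a + e%:Z * d%:Z) (c d))
        /\ s = \sum_(0 <= d < n.+1)
                 'X_(xvar ord0) ^+ d * 'X_(xvar ord_max) ^+ (n - d) * c d]
  | Negz _ => [set 0]
  end.

Lemma bidegD m1 m2 : bideg (m1 + m2)%MM = bideg m1 + bideg m2.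
Proof.
by rewrite /bideg !mnmDE !PoszD mulnDr; congr pair => /=; rewrite ?PoszD; ring.
Qed.

Lemma bihomogM d1 d2 p q :
  bihomog d1 p -> bihomog d2 q -> bihomog (d1 + d2) (p * q).
Proof.
move=> hp hq m /msuppM_le /allpairsP[[m1 m2] /= [/hp h1 /hq h2 ->]].
by rewrite bidegD h1 h2.
Qed.

Lemma bihomogD d p q : bihomog d p -> bihomog d q -> bihomog d (p + q).
Proof.
by move=> hp hq m /msuppD_le; rewrite mem_cat => /orP[/hp|/hq].
Qed.

Lemma bihomogX m : bihomog (bideg m) 'X_[m].
Proof. by move=> m'; rewrite msuppX inE => /eqP ->. Qed.

Lemma bihomogXI d m p : bihomog (bideg m + d) ('X_[m] * p) -> bihomog d p.
Proof.
move=> hp m' hm'; apply: (addrI (bideg m)); rewrite -bidegD; apply: hp.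
by rewrite mulrC (perm_mem (msuppMX _ _)) map_f.
Qed.

Section ZeroLocus.
Variable v : 'I_(2 + 2).

Let kill : cox -> cox := comp_mpoly [tuple if k == v then 0 else 'X_k | k < 2 + 2].

Lemma killM p q : kill (p * q) = kill p * kill q.
Proof. exact: rmorphM. Qed.

Lemma killD p q : kill (p + q) = kill p + kill q.
Proof. exact: raddfD. Qed.

Lemma killXU k : kill 'X_k = if k == v then 0 else 'X_k.
Proof. by rewrite /kill /comp_mpoly mmapX mmap1U tnth_mktuple. Qed.

Lemma killX (m : 'X_{1..2 + 2}) : m v = 0%N -> kill 'X_[m] = 'X_[m].
Proof.
move=> mv; rewrite /kill comp_mpolyX [RHS]mpolyXE_id.
apply: eq_bigr => k _; rewrite tnth_mktuple.
by case: eqP => // ->; rewrite mv !expr0.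
Qed.

Lemma killXv q : kill ('X_v * q) = 0.
Proof. by rewrite killM killXU eqxx mul0r. Qed.

Lemma kill_split p : exists q, p = 'X_v * q + kill p.
Proof.
elim/mpolyind: p => [|c m p _ _ [q eqp]].
  by exists 0; rewrite mulr0 add0r /kill comp_mpoly0.
have [q' eqm] : exists q', 'X_[m] = 'X_v * q' + kill 'X_[m].
  have [mv|mv] := posnP (m v).
    by exists 0; rewrite killX // mulr0 add0r.
  have mE : m = (U_(v) + (m - U_(v)))%MM.
    rewrite addmC submK //; apply/mnm_lepP => k; rewrite mnm1E.
    by case: eqP => // <-.
  exists 'X_[(m - U_(v))%MM]; rewrite -mpolyXD -mE.
  by rewrite [X in kill 'X_[X]]mE mpolyXD killXv addr0.
exists (c *: q' + q); rewrite killD /kill comp_mpolyZ -/kill.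
by rewrite {1}eqp {1}eqm scalerDr mulrDr -scalerAr addrACA.
Qed.

Lemma kill_eq0 p : kill p = 0 -> exists q, p = 'X_v * q.
Proof. by have [q eqp] := kill_split p => k0; exists q; rewrite {1}eqp k0 addr0. Qed.

Lemma kill_factor p : p != 0 -> exists k q, p = 'X_v ^+ k * q /\ kill q != 0.
Proof.
have [N] := ubnP (msize p); elim: N p => // N IH p ltN p0.
have [k0|k0] := eqVneq (kill p) 0; last by exists 0%N, p; rewrite expr0 mul1r.
have [q eqp] := kill_eq0 k0.
have X0 : 'X_v != 0 :> cox by rewrite -msize_poly_eq0 msizeX.
have q0 : q != 0 by apply: contraNneq p0 => q0; rewrite eqp q0 mulr0.
have [|k [r [eqq kr]]] := IH q _ q0.
  by move: ltN; rewrite eqp msizeM // msizeX mdeg1.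
by exists k.+1, r; split=> //; rewrite eqp eqq exprS mulrA.
Qed.

Variables i j : 'I_2.
Hypotheses (vi : v != xvar i) (vj : v != tvar j).

Local Notation D n m := ('X_[chart_mon i j n m] : cox).

Lemma chart_monD n m n' m' :
  chart_mon i j (n + n') (m + m') = (chart_mon i j n m + chart_mon i j n' m')%MM.
Proof.
by apply/mnmP => k; rewrite !mnmDE !mulmnE !mulnDr addnACA.
Qed.

Lemma chart_mon_bidegD n m n' m' :
  bideg (chart_mon i j (n + n') (m + m')) =
  bideg (chart_mon i j n m) + bideg (chart_mon i j n' m').
Proof. by rewrite chart_monD bidegD. Qed.

Lemma DD n m n' m' : D (n + n') (m + m') = D n m * D n' m'.
Proof. by rewrite chart_monD mpolyXD. Qed.

Lemma D_neq0 n m : D n m != 0.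
Proof. by rewrite -msize_poly_eq0 msizeX. Qed.

Lemma fD_neq0 n m : tofrac (D n m) != 0.
Proof. by rewrite tofrac_eq0 D_neq0. Qed.

Lemma killDn n m : kill (D n m) = D n m.
Proof.
rewrite killX // /chart_mon mnmDE !mulmnE !mnm1E.
by rewrite ![_ == v]eq_sym (negbTE vi) (negbTE vj).
Qed.

Lemma D00 : D 0 0 = 1.
Proof.
by rewrite -mpolyX0; congr 'X_[_]; apply/mnmP => k; rewrite mnmDE !mulmnE !muln0.
Qed.

Lemma frac_inj n m n' m' (p q : cox) :
  tofrac p / tofrac (D n m) = tofrac q / tofrac (D n' m') ->
  p * D n' m' = q * D n m.
Proof.
move/eqP; rewrite eqr_div ?fD_neq0 // -!tofracM tofrac_eq => /eqP.
by [].
Qed.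

Lemma chart_idealE n m p : bihomog (bideg (chart_mon i j n m)) p ->
  chart_ideal i j v (tofrac p / tofrac (D n m)) <-> kill p = 0.
Proof.
move=> hp; split=> [[n' [m' [q [hq /frac_inj /(congr1 kill)]]]]|/kill_eq0[q eqp]].
  rewrite !killM killXU eqxx !mul0r killDn => /eqP.
  by rewrite mulf_eq0 (negbTE (D_neq0 _ _)) orbF => /eqP.
by exists n, m, q; rewrite -eqp.
Qed.

Lemma chart_ideal_prime : prime_ideal (chart_ring i j) (chart_ideal i j v).
Proof.
split.
- by move=> h [n [m [q [hq ->]]]]; exists n, m, ('X_v * q).
- exists 0%N, 0%N, 0; rewrite mulr0 tofrac0 mul0r; split=> // k.
  by rewrite msupp0.
- move=> _ _ [n [m [p [hp ->]]]] [n' [m' [q [hq ->]]]].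
  rewrite addf_div ?fD_neq0 // -!tofracM -tofracD -DD.
  exists (n + n')%N, (m + m')%N, (p * D n' m' + q * D n m).
  rewrite mulrDr !mulrA; split=> //; rewrite chart_mon_bidegD.
  apply: bihomogD; first exact: (bihomogM hp (@bihomogX _)).
  rewrite addrC; exact: (bihomogM hq (@bihomogX _)).
- move=> _ _ [n [m [p [hp ->]]]] [n' [m' [q [hq ->]]]].
  rewrite mulf_div -!tofracM -DD.
  exists (n + n')%N, (m + m')%N, (p * q).
  rewrite mulrCA; split=> //; rewrite chart_mon_bidegD.
  exact: bihomogM.
- have h1 : bihomog (bideg (chart_mon i j 0 0)) 1.
    by rewrite -D00; exact: bihomogX.
  have := chart_idealE h1; rewrite D00 tofrac1 divr1 => ->.
  by rewrite -D00 killDn; apply/eqP/D_neq0.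
- move=> _ _ [n [m [p [hp ->]]]] [n' [m' [q [hq ->]]]].
  rewrite mulf_div -!tofracM -DD => /chart_idealE.
  rewrite chart_mon_bidegD => /(_ (bihomogM hp hq)) /eqP.
  rewrite killM mulf_eq0 => /orP[] /eqP; [left|right]; exact/chart_idealE.
Qed.

Variables nc mc n0 m0 : nat.
Hypothesis bideg_eqn :
  bideg (U_(v) + chart_mon i j nc mc)%MM = bideg (chart_mon i j n0 m0).

Let t : fcox := tofrac ('X_v * D nc mc) / tofrac (D n0 m0).

Lemma chart_ideal_height_one :
  height_one_prime (chart_ring i j) (chart_ideal i j v).
Proof.
have X0 : 'X_v != 0 :> cox by rewrite -msize_poly_eq0 msizeX.
have t0 : t != 0 by rewrite mulf_neq0 ?invr_eq0 ?tofrac_eq0 ?mulf_neq0 ?D_neq0.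
have ht : bihomog (bideg (chart_mon i j n0 m0)) ('X_v * D nc mc).
  by rewrite -mpolyXD -bideg_eqn; exact: bihomogX.
have It : chart_ideal i j v t by exists n0, m0, (D nc mc).
split; first exact: chart_ideal_prime.
  by move=> I0; move: It; rewrite I0 /= => /eqP; rewrite (negbTE t0).
move=> J pJ JI; have [J0|J0] := pselect (J `<=` [set 0]).
  left; apply/seteqP; split=> // _ ->; exact: prime_ideal0 pJ.
right; apply/seteqP; split=> //.
(* x / t is regular on the chart for x in the ideal *)
have quot x : chart_ideal i j v x -> exists2 y, chart_ring i j y & x = y * t.
  move=> [n [m [q [hq ->]]]].
  exists (tofrac (q * D n0 m0) / tofrac (D (n + nc) (m + mc))); last first.
    by rewrite /t DD !tofracM; apply: frac_eq1; exact: fD_neq0.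
  exists (n + nc)%N, (m + mc)%N, (q * D n0 m0); split=> //.
  apply: (@bihomogXI _ U_(v)%MM); rewrite mulrA chart_mon_bidegD addrCA.
  by rewrite -bidegD bideg_eqn; exact: (bihomogM hq (@bihomogX _)).
suff Jt : J t.
  by move=> x /quot[y Ay ->]; exact: (prime_idealMl pJ).
have [x [Jx x0]] : exists x, J x /\ x <> 0.
  by move/existsNP: J0 => [x /not_implyP[Jx /= x0]]; exists x.
have [n [m [p [hp ex]]]] := prime_ideal_sub pJ Jx.
have p0 : p != 0.
  by apply/eqP => p0; apply: x0; rewrite ex p0 tofrac0 mul0r.
have [k [q [eqp kq]]] := kill_factor p0.
have Dnk a b l : D a b ^+ l = D (a * l) (b * l).
  elim: l => [|l IH]; first by rewrite !muln0 D00 expr0.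
  by rewrite exprSr IH -DD !mulnSr.
pose u : fcox := tofrac (q * D (n0 * k) (m0 * k))
                 / tofrac (D (n + nc * k) (m + mc * k)).
have xE : x = t ^+ k * u.
  rewrite ex eqp /u /t DD -!Dnk !tofracM !tofracXn.
  by apply: frac_eqX; exact: fD_neq0.
have hu : bihomog (bideg (chart_mon i j (n + nc * k) (m + mc * k)))
                  (q * D (n0 * k) (m0 * k)).
  apply: (@bihomogXI _ (U_(v) *+ k)%MM); rewrite -mpolyXn mulrA -eqp.
  have -> : bideg (U_(v) *+ k) + bideg (chart_mon i j (n + nc * k) (m + mc * k))
     = bideg (chart_mon i j n m) + bideg (chart_mon i j (n0 * k) (m0 * k)).
    rewrite chart_mon_bidegD addrCA; congr (_ + _).
    elim: k {eqp kq u xE} => [|k IH].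
      by rewrite !muln0 -bidegD mulm0n add0m.
    rewrite !mulnSr !chart_mon_bidegD -IH -bideg_eqn mulmSr !bidegD.
    exact: addrACA.
  exact: (bihomogM hp (@bihomogX _)).
have Au : chart_ring i j u by exists (n + nc * k)%N, (m + mc * k)%N, (q * D (n0 * k) (m0 * k)).
have nJu : ~ J u.
  move=> /JI /(chart_idealE hu) /eqP.
  by rewrite killM killDn mulf_eq0 (negbTE kq) (negbTE (D_neq0 _ _)).
have At : chart_ring i j t by exists n0, m0, ('X_v * D nc mc).
have A1 : chart_ring i j 1.
  exists 0%N, 0%N, 1; rewrite D00 tofrac1 divr1; split=> //.
  by rewrite -D00; exact: bihomogX.
have AM x1 x2 : chart_ring i j x1 -> chart_ring i j x2 -> chart_ring i j (x1 * x2).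
  move=> [a1 [b1 [p1 [h1 ->]]]] [a2 [b2 [p2 [h2 ->]]]].
  exists (a1 + a2)%N, (b1 + b2)%N, (p1 * p2).
  by rewrite mulf_div -!tofracM -DD; split=> //; rewrite chart_mon_bidegD; exact: bihomogM.
have AX l : chart_ring i j (t ^+ l).
  by elim: l => [|l IH]; rewrite ?expr0 // exprS; exact: AM.
have {xE} Jtk : J (t ^+ k).
  by move: Jx; rewrite xE => /(prime_idealP pJ (AX _) Au)[].
elim: k Jtk {eqp kq u hu Au nJu} => [/(prime_ideal1 pJ)//|k IH].
by rewrite exprS => /(prime_idealP pJ At (AX _))[].
Qed.

End ZeroLocus.

Lemma Se_height_one :
  height_one_prime (chart_ring ord_max ord0)
                   (chart_ideal ord_max ord0 (xvar ord0)).
Proof.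
apply: (@chart_ideal_height_one _ _ _ _ _ 0 e 1 0) => //.
rewrite bidegD /bideg !mnmDE !mulmnE !mnm1E /=.
by congr pair; rewrite /= ?muln0 ?muln1 ?mul0n ?mul1n; ring.
Qed.

Lemma Fe_height_one :
  height_one_prime (chart_ring ord_max ord_max)
                   (chart_ideal ord_max ord_max (tvar ord0)).
Proof.
apply: (@chart_ideal_height_one _ _ _ _ _ 0 0 0 1) => //.
by rewrite bidegD /bideg !mnmDE !mulmnE !mnm1E /= !muln0.
Qed.

(* S_e = {X_1 = 0} lies in X_2 <> 0 and F_e = {T_1 = 0} in T_2 <> 0; each is
   irreducible, so one chart meeting it determines its generic point. *)
Definition Se : prime_divisor :=
  @PrimeDivisor
    (localization (chart_ring ord_max ord0)
                  (chart_ideal ord_max ord0 (xvar ord0)))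
    (ex_intro _ _ (ex_intro _ _ (ex_intro _ _ (conj Se_height_one erefl)))).

Definition Fe : prime_divisor :=
  @PrimeDivisor
    (localization (chart_ring ord_max ord_max)
                  (chart_ideal ord_max ord_max (tvar ord0)))
    (ex_intro _ _ (ex_intro _ _ (ex_intro _ _ (conj Fe_height_one erefl)))).

End Hirzebruch.

(* Main.v *)
Require Import Defs.
From mathcomp Require Import all_boot all_order all_algebra.
From mathcomp Require Import ring zify fraction mpoly.
From mathcomp Require Import boolp classical_sets cardinality.

(* The Cox ring R = F[X_1, X_2, T_1, T_2] is factorial and graded by the group
   Z^2 of bidegrees, and the factors of a bihomogeneous polynomial are
   bihomogeneous.  The group of bidegrees has a basis made of those of X_i and
   T_j, so multiplying by a Laurent monomial in X_i, T_j moves any bidegree to 0.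
   Hence the height one primes of the chart U_ij correspond to the
   bihomogeneous primes p of R dividing neither X_i nor T_j; the local ring of
   such a p consists of the fractions of bidegree 0 whose denominator is prime to
   p, and its valuation is the multiplicity of p.  Consequently h lies in L(G)
   iff w = h X_1^a T_1^b / f, which is homogeneous of bidegree (a, b - ea), has a
   nonnegative multiplicity at every bihomogeneous prime.  By unique
   factorization this says that w is a polynomial, and the polynomials of
   bidegree (a, b - ea) are the elements of L_*. *)

Set Implicit Arguments.
Unset Strict Implicit.
Unset Printing Implicit Defensive.

Import Order.TTheory GRing.Theory Num.Theory.

Local Open Scope ring_scope.
Local Open Scope classical_set_scope.

(** * Factorial rings *)

Section Factorial.
Variable R : idomainType.
Implicit Types x y p : R.

Definition rdvd p x : Prop := exists c, x = p * c.

Definition prime_elt p : Prop :=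
  [/\ p != 0, p \isn't a GRing.unit &
      forall x y, rdvd p (x * y) -> rdvd p x \/ rdvd p y].

(** A factorization into prime elements, unlike one into irreducible elements, is automatically
    unique up to units and order, so its existence characterizes factorial rings. *)
Inductive prime_product : R -> Prop :=
| PrimeProductUnit u of u \is a GRing.unit : prime_product u
| PrimeProductM p x of prime_elt p & prime_product x : prime_product (p * x).

Definition factorial_ring : Prop := forall x, x != 0 -> prime_product x.

Lemma rdvd_mulr p x y : rdvd p x -> rdvd p (x * y).
Proof. by move=> [c ->]; exists (c * y); rewrite mulrA. Qed.

Lemma rdvd_mull p x y : rdvd p y -> rdvd p (x * y).
Proof. by rewrite mulrC; exact: rdvd_mulr. Qed.

Lemma rdvdD p x y : rdvd p x -> rdvd p y -> rdvd p (x + y).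
Proof. by move=> [c ->] [d ->]; exists (c + d); rewrite mulrDr. Qed.

Lemma rdvd_trans x y z : rdvd x y -> rdvd y z -> rdvd x z.
Proof. by move=> [c ->] [d ->]; exists (c * d); rewrite mulrA. Qed.

Lemma prime_elt_ndvd_unit p u : prime_elt p -> u \is a GRing.unit -> ~ rdvd p u.
Proof. by move=> [_ nu _] uu [c uE]; move: uu; rewrite uE unitrM (negbTE nu). Qed.

(** In [q = p * c] the prime [q] divides [p] or [c]; in the second case, cancelling [q] would make
    [p] a unit. *)
Lemma rdvd_prime p q : prime_elt p -> prime_elt q -> rdvd p q -> rdvd q p.
Proof.
move=> [_ nup _] [q0 _ qP] [c qE].
have [//|[d cE]] : rdvd q p \/ rdvd q c by apply: qP; exists 1; rewrite mulr1.
case/negP: nup; apply/unitrPr; exists d; apply: (mulfI q0).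
by rewrite mulr1 mulrCA -cE.
Qed.

Lemma prime_product_neq0 x : prime_product x -> x != 0.
Proof.
elim=> [u uu|p y [p0 _ _] _ y0]; last by rewrite mulf_neq0.
by apply: contraTneq uu => ->; rewrite unitr0.
Qed.

Lemma prime_productM x y :
  prime_product x -> prime_product y -> prime_product (x * y).
Proof.
move=> ppx ppy; elim: ppx => [u uu|p z pP _]; last first.
  by rewrite -mulrA; exact: PrimeProductM.
elim: ppy => [w uw|p z pP _]; first by apply: PrimeProductUnit; rewrite unitrM uu.
by rewrite mulrCA; exact: PrimeProductM.
Qed.

(** A prime factor divisible by [p] is associated to [p] and raises the exponent by one; every other
    factor goes into the cofactor. *)
Lemma prime_multiplicity p x : prime_elt p -> prime_product x ->
  exists k y, x = p ^+ k * y /\ ~ rdvd p y.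
Proof.
move=> pp; elim=> [u uu|q y qq _ [k [z [-> npz]]]].
  by exists 0%N, u; rewrite mul1r; split=> //; exact: prime_elt_ndvd_unit.
have [_ _ pP] := pp; have [p0 _ _] := pp.
have [pq|npq] := pselect (rdvd p q); last first.
  by exists k, (q * z); rewrite mulrCA; split=> // /pP[].
have [c qE] := pq; have [d pE] := rdvd_prime pp qq pq.
have uc : c \is a GRing.unit.
  apply/unitrPr; exists d; apply: (mulfI p0).
  by rewrite mulr1 mulrA -qE -pE.
exists k.+1, (c * z); rewrite {1}qE exprS mulrACA; split=> // /pP[]//.
exact: prime_elt_ndvd_unit.
Qed.

End Factorial.

(** * Gauss's lemma: polynomials over a factorial ring *)

Section Gauss.
Variable R : idomainType.
Hypothesis factR : factorial_ring R.
Implicit Types (c p : R) (f g h : {poly R}).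

Lemma rdvd_polyC p f : rdvd p%:P f <-> forall i, rdvd p f`_i.
Proof.
split=> [[g ->] i|pf]; first by exists g`_i; rewrite coefCM.
have [c cE] := choice pf; exists (\poly_(i < size f) c i).
apply/polyP => i; rewrite coefCM coef_poly; case: ltnP => // ?.
by rewrite mulr0 nth_default.
Qed.

(** If [p] divides neither [f] nor [g], let [i] and [j] be the least indices of coefficients not
    divisible by [p]. In the coefficient [i + j] of the product, every term except $f_i g_j$ is a
    multiple of [p]. *)
Lemma prime_polyC p : prime_elt p -> prime_elt p%:P.
Proof.
move=> [p0 nup pP]; split; rewrite ?polyC_eq0 //.
  by rewrite poly_unitE coefC eqxx (negbTE nup) andbF.
move=> f g pfg; apply: contrapT => /not_orP[].
have least h : ~ rdvd p%:P h ->
    exists i, ~ rdvd p h`_i /\ forall k, (k < i)%N -> rdvd p h`_k.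
  move=> nph; have ex : exists i, `[< ~ rdvd p h`_i >].
    by apply: contrapT => nex; apply: nph; apply/rdvd_polyC => i;
       apply: contrapT => npi; apply: nex; exists i; apply/asboolP.
  case: (ex_minnP ex) => i /asboolP npi mini; exists i; split=> // k ki.
  by apply: contrapT => npk; move: ki; rewrite ltnNge mini //; exact/asboolP.
move=> /least[i [npi iP]] /least[j [npj jP]].
have /rdvd_polyC/(_ (i + j)%N) := pfg.
rewrite coefM (bigD1 (inord i)) //= inordK ?ltnS ?leq_addr // addKn => pS.
suff /pP[] : rdvd p (f`_i * g`_j) by [].
rewrite -[_ * _](addrK (\sum_(k < (i + j).+1 | k != inord i) f`_k * g`_(i + j - k))).
apply: rdvdD => //; rewrite -mulN1r; apply: rdvd_mull.
elim/big_ind: _ => [|x y|k ki]; [by exists 0; rewrite mulr0|exact: rdvdD|].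
have [lt_ki|lt_ik|eq_ki] := ltngtP k i.
- by apply: rdvd_mulr; exact: iP.
- by apply: rdvd_mull; apply: jP; rewrite ltn_subLR ?ltn_add2r // -ltnS.
- by case/eqP: ki; apply: val_inj; rewrite /= inordK ?eq_ki // ltnS leq_addr.
Qed.

Lemma prime_product_polyC c : prime_product c -> prime_product c%:P.
Proof.
elim=> [u uu|p y pP _]; first by apply: PrimeProductUnit; exact: rmorph_unit.
by rewrite polyCM; apply: PrimeProductM; exact: prime_polyC.
Qed.

Definition primitive f := forall p, prime_elt p -> ~ rdvd p%:P f.

(* Divide out the prime factors of [m] one by one; those of [k] are already
   known not to divide [f]. *)
Lemma primitive_part f : f != 0 ->
  exists c g, [/\ c != 0, f = c *: g & primitive g].
Proof.
move=> f0.
(* The induction follows a factorization of [l = m * r]: a prime of [l] found in [r] is discarded,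
   one found in [m] is divided out of [f] or moved to [k]. It starts with [k = r = 1]. *)
suff main l : prime_product l -> forall k m r f, lead_coef f = k * m ->
    m * r = l -> (forall p, prime_elt p -> rdvd p k -> ~ rdvd p%:P f) ->
    exists c g, [/\ c != 0, f = c *: g & primitive g].
  apply: (main (lead_coef f) _ 1 (lead_coef f) 1); rewrite ?mul1r ?mulr1 //.
    by apply: factR; rewrite lead_coef_eq0.
  by move=> p pP /prime_elt_ndvd_unit []; rewrite ?unitr1.
elim=> {l f f0} [u uu|p l pP _ IH] k m r f lf mr kP.
  exists 1, f; rewrite oner_neq0 scale1r; split=> // p pP pf.
  have : rdvd p (k * m) by rewrite -lf lead_coefE; move/rdvd_polyC: pf; exact.
  case: (pP) => _ _ primp /primp[/kP/(_ pf)//|pm].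
  by apply: (prime_elt_ndvd_unit pP uu); rewrite -mr; exact: rdvd_mulr.
case: (pP) => p0 _ primp.
have /primp[[m' mE]|[r' rE]] : rdvd p (m * r) by exists l.
  have m'r : m' * r = l by apply: (mulfI p0); rewrite mulrA -mE.
  have [[g fE]|npf] := pselect (rdvd p%:P f).
    have [||c [h [c0 gE ph]]] := IH k m' r g _ m'r.
    - apply: (mulfI p0); rewrite mulrCA -mE -lf fE lead_coefM lead_coefC //.
    - move=> q qP qk qg; apply: (kP q) => //.
      by rewrite fE; exact: rdvd_mull.
    exists (p * c), h; split=> //; first by rewrite mulf_neq0.
    by rewrite -scalerA -gE fE mul_polyC.
  apply: (IH (k * p) m' r) => //; first by rewrite -mulrA -mE.
  move=> q qP; case: (qP) => _ _ primq /primq[/kP//|qp]; first exact.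
  have [c pE] := rdvd_prime qP pP qp.
  move=> [g fE]; apply: npf; rewrite fE.
  apply: rdvd_mulr; have [d ->] := rdvd_prime qP pP qp.
  by exists d%:P; rewrite polyCM.
apply: (IH k m r') => //; apply: (mulfI p0).
by rewrite mulrCA -rE.
Qed.

(** A prime factor of [c] divides the product of [f] with the quotient, but not the primitive [f];
    hence it divides the quotient and can be cancelled. *)
Lemma primitive_cancel c f g : c != 0 -> primitive f -> rdvd f (c *: g) -> rdvd f g.
Proof.
move=> /factR + pf; elim=> [u uu|p x pP _ IH] [h].
  move=> gE; exists (u^-1 *: h); rewrite -scalerAr -gE.
  by rewrite scalerA mulVr // scale1r.
rewrite -scalerA -mul_polyC => fh; apply: IH.
have [p0 _ primp] := prime_polyC pP.
have /primp[/(pf _ pP)//|[h' hE]] : rdvd p%:P (f * h) by exists (x *: g).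
by exists h'; apply: (mulfI p0); rewrite fh hE mulrCA.
Qed.

(** Gauss's lemma in the form that clears denominators: each prime of [c] divides [g] or [h] and is
    cancelled there, while [d] collects the primes taken out of [h]. *)
Lemma scaled_factor c f g h : c != 0 -> c *: f = g * h ->
  exists d g' h', [/\ f = g' * h', size g' = size g, d != 0 & h = d *: h'].
Proof.
move=> /factR ppc; elim: ppc g h => [u uu|p x pP _ IH] g h fE.
  exists 1, (u^-1 *: g), h; rewrite oner_neq0 scale1r; split=> //.
    by rewrite -scalerAl -fE scalerA mulVr // scale1r.
  by rewrite size_scale ?invr_eq0 //; apply: contraTneq uu => ->; rewrite unitr0.
have [p0 _ primp] := prime_polyC pP; have [p0' _ _] := pP.
have /primp[[g1 gE]|[h1 hE]] : rdvd p%:P (g * h).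
- by exists (x *: f); rewrite -fE mul_polyC scalerA.
- have [|d [g' [h' [-> sg' d0 ->]]]] := IH g1 h.
    by apply: (mulfI p0); rewrite mulrA -gE -fE mul_polyC scalerA.
  exists d, g', h'; split=> //.
  by rewrite sg' gE mul_polyC size_scale.
- have [|d [g' [h' [-> sg' d0 h1E]]]] := IH g h1.
    by apply: (mulfI p0); rewrite mulrCA -hE -fE mul_polyC scalerA.
  exists (p * d), g', h'; split=> //; first by rewrite mulf_neq0.
  by rewrite hE h1E mul_polyC scalerA.
Qed.

(* If [f] divides [g * h] but neither factor, a nonzero element [d] of
   least degree in the ideal [(f, g)] divides [f] up to a scalar, so [d] is
   either a constant or [f] up to a scalar. *)
Lemma irreducible_primitive_prime f : (1 < size f)%N -> primitive f ->
  (forall g h, f = g * h -> (size f <= size g)%N \/ (size f <= size h)%N) ->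
  prime_elt f.
Proof.
move=> sf pf irrf.
have f0 : f != 0 by rewrite -size_poly_gt0 ltnW.
split=> //; first by rewrite poly_unitE gtn_eqF.
move=> g h fgh; apply: contrapT => /not_orP[nfg nfh].
pose I (d : {poly R}) := exists u v : {poly R}, d = u * f + v * g.
have ex : exists n, `[< exists2 d : {poly R}, I d & d != 0 /\ size d = n >].
  exists (size f); apply/asboolP; exists f => //.
  by exists 1, 0; rewrite mul0r mul1r addr0.
case: (ex_minnP ex) => n /asboolP[d [u [v dE]] [d0 sd]] mind.
(* Pseudo-division by [d] leaves a remainder that lies in the ideal and is smaller than [d];
   minimality of [n] makes it 0. *)
have divI (z : {poly R}) : I z -> exists2 c, c != 0 & rdvd d (c *: z).
  move=> [a [b zE]]; exists (lead_coef d ^+ scalp z d).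
    by rewrite expf_neq0 // lead_coef_eq0.
  have := Pdiv.Idomain.divp_eq z d; set c := _ ^+ _; set q := z %/ d => zq.
  suff r0 : z %% d = 0 by exists q; rewrite zq r0 addr0 mulrC.
  apply: contrapT => /eqP r0.
  have : (n <= size (z %% d)%R)%N.
    apply: mind; apply/asboolP; exists (z %% d) => //.
    have -> : z %% d = c *: z - q * d by rewrite zq addrC addKr.
    exists (c *: a - q * u), (c *: b - q * v); rewrite zE dE.
    by rewrite -!mul_polyC; ring.
  by rewrite -sd leqNgt Pdiv.Idomain.ltn_modp d0.
have [c c0 [q fE]] : exists2 c, c != 0 & rdvd d (c *: f).
  by apply: divI; exists 1, 0; rewrite mul0r mul1r addr0.
rewrite mulrC in fE.
have [k [q' [d' [fE' _ k0 dE']]]] := scaled_factor c0 fE.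
have q'0 : q' != 0 by apply: contraNneq f0 => q'0; rewrite fE' q'0 mul0r.
have d'0 : d' != 0 by apply: contraNneq f0 => d'0; rewrite fE' d'0 mulr0.
have sz : (size q' + size d' = (size f).+1)%N.
  rewrite {1}fE' size_mul // prednK // addn_gt0 size_poly_gt0 q'0 //.
(* By sizes, either [d] is constant, and [f] divides [d * h = u * f * h + v * g * h], or [q'] is
   constant, so that [d] and [f] agree up to constants and [f] divides a constant multiple of [g].
   Primitivity of [f] then removes the constant. *)
have [le_q|le_d] := irrf _ _ fE'.
  have sd' : (size d' <= 1)%N by rewrite -(leq_add2l (size q')) addn1 sz ltnS.
  have s1 : (size d <= 1)%N by rewrite dE' size_scale.
  have d1E := size1_polyC s1.
  apply: nfh; apply: (@primitive_cancel d`_0) => //.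
    by rewrite -polyC_eq0 -d1E.
  rewrite -mul_polyC -d1E dE mulrDl; apply: rdvdD.
    by rewrite -mulrA mulrCA; exists (u * h).
  by rewrite -mulrA; apply: rdvd_mull.
have s1 : (size q' <= 1)%N by rewrite -(leq_add2r (size d')) sz add1n ltnS.
have q1E := size1_polyC s1.
have [a a0 [r gE]] : exists2 a, a != 0 & rdvd d (a *: g).
  by apply: divI; exists 0, 1; rewrite mul0r mul1r add0r.
apply: nfg; apply: (@primitive_cancel (q'`_0 * a)) => //.
  by rewrite mulf_neq0 // -polyC_eq0 -q1E.
exists (k *: r); rewrite -scalerA gE dE' fE' {2}q1E.
by rewrite -!mul_polyC; ring.
Qed.

(** Induction on the size. The content factors in [R]; the primitive part is a constant, or a
    product of two smaller polynomials, or prime by [irreducible_primitive_prime]. *)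
Lemma factorial_poly : factorial_ring {poly R}.
Proof.
move=> f; have [n] := ubnP (size f); elim: n f => // n IH f ltn f0.
have [c [g [c0 fE pg]]] := primitive_part f0.
have g0 : g != 0 by apply: contraNneq f0 => g0; rewrite fE g0 scaler0.
rewrite fE -mul_polyC; apply: prime_productM.
  by apply: prime_product_polyC; exact: factR.
have sg : size g = size f by rewrite fE size_scale.
have [s1|s1] := leqP (size g) 1.
  rewrite (size1_polyC s1); apply: prime_product_polyC; apply: factR.
  by rewrite -polyC_eq0 -size1_polyC.
have [[a [b [gE sa sb]]]|irr] := pselect (exists a b,
    [/\ g = a * b, (size a < size g)%N & (size b < size g)%N]).
  have a0 : a != 0 by apply: contraNneq g0 => a0; rewrite gE a0 mul0r.
  have b0 : b != 0 by apply: contraNneq g0 => b0; rewrite gE b0 mulr0.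
  rewrite gE; apply: prime_productM; apply: IH => //.
    by rewrite (leq_trans sa) // sg.
  by rewrite (leq_trans sb) // sg.
rewrite -[g]mulr1; apply: PrimeProductM.
  apply: irreducible_primitive_prime => // a b gE.
  apply: contrapT => /not_orP[/negP sa /negP sb].
  by apply: irr; exists a, b; rewrite !ltnNge.
by apply: PrimeProductUnit; exact: unitr1.
Qed.

End Gauss.

Lemma factorial_ring_iso (R S : idomainType) (phi : {rmorphism R -> S})
    (psi : {rmorphism S -> R}) :
  cancel phi psi -> cancel psi phi -> factorial_ring S -> factorial_ring R.
Proof.
move=> phiK psiK factS x x0.
have prime_psi p : prime_elt p -> prime_elt (psi p).
  move=> [p0 nup pP]; split.
  - by apply: contraNneq p0 => psi0; rewrite -(psiK p) psi0 rmorph0.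
  - by apply: contra nup => /(rmorph_unit phi); rewrite psiK.
  - move=> y z [c yzE].
    have : rdvd p (phi y * phi z).
      by exists (phi c); rewrite -rmorphM yzE rmorphM psiK.
    by case/pP=> [[d dE]|[d dE]]; [left|right]; exists (psi d);
       rewrite -rmorphM -dE phiK.
have : phi x != 0 by apply: contraNneq x0 => phi0; rewrite -(phiK x) phi0 rmorph0.
move=> /factS; rewrite -{2}(phiK x); elim=> [u uu|p y pP _ IH].
  by apply: PrimeProductUnit; exact: rmorph_unit.
by rewrite rmorphM; apply: PrimeProductM => //; exact: prime_psi.
Qed.

(** * Adding one variable to a multivariate polynomial ring *)

Section MpolyFactorial.
Variables (n : nat) (R : idomainType).

Let psi : {rmorphism {poly {mpoly R[n]}} -> {mpoly R[n.+1]}} :=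
  horner_eval ('X_ord_max : {mpoly R[n.+1]}) \o map_poly (@mwiden n R).

Lemma muniX (m : 'X_{1..n.+1}) : muni ('X_[m] : {mpoly R[n.+1]}) =
  'X_[[multinom (m (widen_ord (leqnSn n) i)) | i < n]] *: 'X^(m ord_max).
Proof. by rewrite muniE msuppX big_seq1 mcoeffX eqxx scale1r. Qed.

Lemma muniK : cancel (@muni n R) psi.
Proof.
have psiE p : psi p = (map_poly (@mwiden n R) p).['X_ord_max] by [].
have psiD : {morph psi : x y / x + y} by exact: rmorphD.
have psiM : {morph psi : x y / x * y} by exact: rmorphM.
elim/mpolyind => [|c m p _ _ IH]; first by rewrite muni0; exact: (rmorph0 psi).
suff cmK : psi (muni (c *: 'X_[m])) = c *: 'X_[m].
  by rewrite muniD psiD; exact: (congr2 +%R cmK IH).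
rewrite muniZ muniX -!mul_polyC !psiM !psiE !map_polyC /= map_polyXn.
rewrite !hornerC hornerXn mwidenC mwidenX mul_mpolyC; congr (_ *: _).
rewrite mpolyXn -mpolyXD; congr 'X_[_]; apply/mnmP => i.
rewrite mnmDE mulmnE mnm1E; case: (unliftP ord_max i) => [j|] ->.
  have -> : lift ord_max j = widen_ord (leqnSn n) j.
    by apply: val_inj; rewrite /= /bump leqNgt ltn_ord.
  by rewrite mnmwiden_widen mnmE -val_eqE /= gtn_eqF ?muln0 ?addn0.
by rewrite mnmwiden_ordmax eqxx mul1n.
Qed.

Lemma muni_mwiden (p : {mpoly R[n]}) : muni (mwiden p) = p%:P.
Proof.
elim/mpolyind: p => [|c m p _ _ IH]; first by rewrite mwiden0 muni0.
rewrite mwidenD muniD IH polyCD mwidenZ mwidenX muniZ muniX; congr (_ + _).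
rewrite mnmwiden_ordmax expr0 alg_polyC -mul_polyC -polyCM -mul_mpolyC.
congr (_ * _)%:P; congr 'X_[_]; apply/mnmP => i.
by rewrite mnmE mnmwiden_widen.
Qed.

Lemma mmultiK : cancel psi (@muni n R).
Proof.
have psiE p : psi p = (map_poly (@mwiden n R) p).['X_ord_max] by [].
elim/poly_ind => [|p c IH]; first by rewrite (rmorph0 psi) muni0.
rewrite (rmorphD psi) (rmorphM psi) [psi 'X]psiE [psi c%:P]psiE.
rewrite map_polyX map_polyC hornerX hornerC /=.
rewrite muniD muniM IH muni_mwiden; congr (p * _ + _).
rewrite muniX mnm1E eqxx expr1 -[RHS]scale1r; congr (_ *: _).
rewrite -mpolyX0; congr 'X_[_]; apply/mnmP => i.
by rewrite mnmE mnm1E mnm0E -val_eqE /= gtn_eqF.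
Qed.

Lemma factorial_mpolyS :
  factorial_ring {mpoly R[n]} -> factorial_ring {mpoly R[n.+1]}.
Proof. by move=> /factorial_poly; exact: factorial_ring_iso muniK mmultiK. Qed.

End MpolyFactorial.

Lemma factorial_mpoly (F : fieldType) n : factorial_ring {mpoly F[n]}.
Proof.
elim: n => [|n]; last exact: factorial_mpolyS.
move=> p p0; apply: PrimeProductUnit.
have pE : p = (p@_0)%:MP.
  by apply/mpolyP => m; rewrite mcoeffC (_ : m = 0%MM) ?eqxx ?mulr1 //; apply/mnmP => -[].
rewrite pE; apply: rmorph_unit; rewrite unitfE.
by apply: contraNneq p0 => c0; rewrite pE c0 mpolyC0.
Qed.

(** * Bihomogeneous polynomials *)

(** Induction on [d]: if [d > 0], the product vanishes at 0, so ['X] divides one of the factors and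
    can be cancelled; if [d = 0], sizes show that [p] is constant. *)
Lemma monomial_factor (R : idomainType) d (a : R) (p q : {poly R}) :
  a != 0 -> p * q = a%:P * 'X^d -> exists b k, p = b%:P * 'X^k.
Proof.
move=> a0; have X0 := polyX_eq0 R; elim: d p q => [|d IH] p q pqE.
  have [p0 q0] : p != 0 /\ q != 0.
    by apply/andP; rewrite -negb_or -mulf_eq0 pqE expr0 mulr1 polyC_eq0.
  have : size (p * q) = 1%N by rewrite pqE expr0 mulr1 size_polyC a0.
  rewrite size_mul // => sz; have sp : (size p <= 1)%N.
    by move: sz q0; rewrite -size_poly_gt0; lia.
  by exists p`_0, 0%N; rewrite expr0 mulr1; exact: size1_polyC.
have : root (p * q) 0 by rewrite pqE rootE hornerM hornerXn expr0n mulr0.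
rewrite rootM => /orP[] /factor_theorem[r]; rewrite subr0 => rE.
  have [|b [k rE']] := IH r q.
    by apply: (mulIf (negbT X0)); rewrite mulrAC -rE pqE -mulrA -exprSr.
  by exists b, k.+1; rewrite rE rE' exprSr mulrA.
apply: (IH p r); apply: (mulIf (negbT X0)).
by rewrite -mulrA -rE pqE -mulrA -exprSr.
Qed.

Section WeightedHomogeneity.
Variables (R : idomainType) (n : nat) (w : 'I_n -> nat).
Implicit Types (m : 'X_{1..n}) (p q : {mpoly R[n]}).

Definition wdeg m : nat := \sum_i w i * m i.

Definition whomog (k : nat) p : Prop := forall m, m \in msupp p -> wdeg m = k.

(* The substitution [X_i := z ^ w_i X_i]; the weighted homogeneous polynomials
   are those sent to a monomial in [z]. *)
Let twist : {rmorphism {mpoly R[n]} -> {poly {mpoly R[n]}}} :=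
  mmap (polyC \o @mpolyC n R) (fun i => ('X_i)%:P * 'X^(w i)).

Let twistE p : twist p = \sum_(m <- msupp p) (p@_m *: 'X_[m])%:P * 'X^(wdeg m).
Proof.
apply: eq_bigr => m _; rewrite /mmap1 /=.
under eq_bigr => i _ do rewrite exprMn -exprM.
rewrite big_split /= prodrXr -mul_mpolyC polyCM -mulrA; congr (_ * (_ * _)).
rewrite [in RHS]mpolyXE_id rmorph_prod; apply: eq_bigr => i _.
by rewrite rmorphXn.
Qed.

Let twist_at1 p : (twist p).[1] = p.
Proof.
rewrite twistE horner_sum [RHS]mpolyE; apply: eq_bigr => m _.
by rewrite hornerCM hornerXn expr1n mulr1.
Qed.

Let whomogP k p : whomog k p <-> twist p = p%:P * 'X^k.
Proof.
split=> [hp|pE m].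
  rewrite {2}(mpolyE p) rmorph_sum mulr_suml twistE.
  by apply: eq_big_seq => m /hp ->.
rewrite mcoeff_msupp => pm; apply: contraNeq pm => /negbTE wm.
have := congr1 (fun q : {poly {mpoly R[n]}} => (q`_(wdeg m))@_m) pE.
rewrite coefCM coefXn wm mulr0 mcoeff0 twistE coef_sum raddf_sum /=.
move=> s0; apply/eqP; rewrite -s0 {1}(mpolyE p) raddf_sum /=.
apply: eq_bigr => m' _; rewrite coefCM coefXn.
have [_|wm'] := eqVneq (wdeg m) (wdeg m'); first by rewrite mulr1.
rewrite mulr0 mcoeff0 mcoeffZ mcoeffX; have [m'm|_] := eqVneq m' m.
  by rewrite m'm eqxx in wm'.
by rewrite mulr0.
Qed.

(** The twists of [p] and [q] multiply to a monomial in [z], so the twist of [p] is a monomial $b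
    z^l$, and putting $z = 1$ gives $b = p$. *)
Lemma whomog_factor k p q : p * q != 0 -> whomog k (p * q) -> exists l, whomog l p.
Proof.
move=> pq0 /whomogP; rewrite rmorphM => /(monomial_factor pq0)[b [l pE]].
exists l; apply/whomogP; rewrite pE; congr (_%:P * _).
by rewrite -(twist_at1 p) pE hornerCM hornerXn expr1n mulr1.
Qed.

End WeightedHomogeneity.

Section Bihomogeneous.
Variables (F : finFieldType) (e : nat).
Local Notation cox := {mpoly F[2 + 2]}.
Implicit Types (p q : cox) (d : int * int).

Lemma bihomog_factor d p q :
  p * q != 0 -> bihomog e d (p * q) -> exists d', bihomog e d' p.
Proof.
move=> pq0 hpq.
(* Weights must be natural numbers, whereas [X_1] has second degree [-e]. So [w2] is the second
   degree plus [e] times the first: [X_1], [X_2] and the [T_j] get the weights 0, [e] and 1. *)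
pose w1 (i : 'I_(2 + 2)) : nat := if split i is inl _ then 1%N else 0%N.
pose w2 (i : 'I_(2 + 2)) : nat := if split i is inl i then
  (if i == ord_max then e else 0%N) else 1%N.
have lr (i : 'I_2) : split (lshift 2 i) = inl i by exact: (unsplitK (inl i)).
have rr (i : 'I_2) : split (rshift 2 i) = inr i by exact: (unsplitK (inr i)).
have ord1E : lift ord0 ord0 = ord_max :> 'I_2 by exact: val_inj.
have w1E m : wdeg w1 m = (m (xvar ord0) + m (xvar ord_max))%N.
  rewrite /wdeg big_split_ord !big_ord_recl !big_ord0 /w1 !lr !rr ord1E /=.
  by rewrite ?mul0n ?mul1n ?addn0 ?add0n ?addnA.
have w2E m : wdeg w2 m =
    (e * m (xvar ord_max) + (m (tvar ord0) + m (tvar ord_max)))%N.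
  rewrite /wdeg big_split_ord !big_ord_recl !big_ord0 /w2 !lr !rr ord1E /=.
  by rewrite ?mul0n ?mul1n ?addn0 ?add0n ?addnA.
have bidegE m : bideg e m = ((wdeg w1 m)%:Z, (wdeg w2 m)%:Z - (e * wdeg w1 m)%:Z).
  rewrite w1E w2E /bideg !PoszD mulnDr !PoszD; congr pair; ring.
have [|k1 h1] := @whomog_factor _ _ w1 `|d.1|%N p q pq0.
  by move=> m /hpq <-; rewrite bidegE.
have [|k2 h2] := @whomog_factor _ _ w2 `|(d.2 + e%:Z * d.1)%R|%N p q pq0.
  by move=> m /hpq <-; rewrite bidegE /= PoszM subrK.
exists (k1%:Z, k2%:Z - (e * k1)%:Z) => m mp.
by rewrite bidegE (h1 m mp) (h2 m mp).
Qed.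

Lemma bihomog_inj d d' p :
  p != 0 -> bihomog e d p -> bihomog e d' p -> d = d'.
Proof. by move=> /mlead_supp mp hd hd'; rewrite -(hd _ mp) -(hd' _ mp). Qed.

Lemma bihomog_cofactor d d' p q : p != 0 -> q != 0 ->
  bihomog e d p -> bihomog e d' (p * q) -> bihomog e (d' - d) q.
Proof.
move=> p0 q0 hp hpq; have pq0 : p * q != 0 by rewrite mulf_neq0.
have [d'' hq] : exists d'', bihomog e d'' q.
  by apply: (@bihomog_factor d' q p); rewrite mulrC.
by rewrite (bihomog_inj pq0 hpq (bihomogM hp hq)) addrC addKr.
Qed.

End Bihomogeneous.

(** * Orders of vanishing *)

Lemma div_exprz_split (K : fieldType) (a x : K) (n : int) (k : nat) : a != 0 ->
  x / a ^ n = a * (a ^+ k * (x / a ^ (n + 1 + k%:Z))).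
Proof.
move=> a0; rewrite !expfzDr // expr1z -exprnP; field.
by rewrite a0 expf_neq0 // expfz_neq0.
Qed.

Section Valuation.
Variables (K : fieldType) (O : set K).
Hypotheses (O1 : O 1) (OM : forall x y, O x -> O y -> O (x * y)).

Lemma unit_inM x y : unit_in O x -> unit_in O y -> unit_in O (x * y).
Proof.
move=> [x0 Ox Ox'] [y0 Oy Oy']; split; first by rewrite mulf_neq0.
  exact: OM.
by rewrite invfM; exact: OM.
Qed.

Lemma unit_inV x : unit_in O x -> unit_in O x^-1.
Proof. by move=> [x0 Ox Ox']; split; rewrite ?invr_eq0 ?invrK. Qed.

Lemma unit_inX x n : unit_in O x -> unit_in O (x ^+ n).
Proof.
move=> Ux; elim: n => [|n IH]; last by rewrite exprS; exact: unit_inM.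
by rewrite expr0; split; rewrite ?invr1 ?oner_eq0.
Qed.

Lemma unit_in_exprz x (n : int) : unit_in O x -> unit_in O (x ^ n).
Proof. by case: n => n Ux; [|apply: unit_inV]; exact: unit_inX. Qed.

Lemma unit_in_exprzI x (n : int) : O x -> unit_in O (x ^ n) -> n != 0 -> unit_in O x.
Proof.
move=> Ox; have OX k : O (x ^+ k).
  by elim: k => [|k IH]; rewrite ?expr0 // exprS; exact: OM.
have pos k : unit_in O (x ^+ k.+1) -> unit_in O x.
  rewrite exprS => -[xk0 _ Oxk]; move: xk0; rewrite mulf_eq0 negb_or => /andP[x0 xk0].
  by split=> //; have := OM (OX k) Oxk; rewrite invfM mulrCA divff // mulr1.
case: n => [[|k]|k] // Uxk _; first exact: pos Uxk.
by apply: (@pos k); rewrite -[x ^+ _]invrK; exact: unit_inV.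
Qed.

(** The choice made by [xget] is forced: two uniformizers differ by a unit, so two candidate
    exponents [m] and [n] make [p ^ (m - n)] a unit, and [p] itself would be one if they
    differed. *)
Lemma val_inP p x (n : int) :
  uniformizer O p -> unit_in O (x / p ^ n) -> val_in O x = n.
Proof.
move=> up Ux; rewrite /val_in.
apply: xget_unique; first by exists p.
move=> m [q uq Uxq]; have [p0 Op nUp pP] := up; have [q0 Oq nUq qP] := uq.
have Uqp : unit_in O (q / p).
  split; first by rewrite mulf_neq0 ?invr_eq0.
    exact: pP.
  by rewrite invfM invrK mulrC; exact: qP.
have [//|mn] := eqVneq m n.
case: nUp; apply: (@unit_in_exprzI _ (m - n)); rewrite ?subr_eq0 //.
have -> : p ^ (m - n) = (q / p) ^ (- m) * (x / p ^ n) * (x / q ^ m)^-1.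
  have [x0 _ _] := Ux; have x0' : x != 0.
    by apply: contraNneq x0 => ->; rewrite mul0r.
  rewrite expfzDr // -!invr_expz expfzMl -expfV; field.
  by rewrite x0' !expfz_neq0.
apply: unit_inM; last exact: unit_inV.
by apply: unit_inM => //; exact: unit_in_exprz.
Qed.

End Valuation.

(** * Graded localizations of the Cox ring *)

Section GradedFractions.
Variables (F : finFieldType) (e : nat).
Local Notation cox := {mpoly F[2 + 2]}.
Local Notation fcox := {fraction cox}.
Local Notation bihomog := (@bihomog F e).
Implicit Types (A B p q : cox) (x y z : fcox) (d : int * int) (S T : set cox).

(** With [S = setT] this is the degree [d] part of the localization at [T]; with [S = T] it consists
    of homogeneous units of that localization. Inversion exchanges [S] and [T]. *)
Definition grfrac S T d : set fcox :=
  [set x | exists d' A B, [/\ bihomog (d + d') A, bihomog d' B,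
     S A /\ T B, B != 0 & x = tofrac A / tofrac B]].

Definition mul_closed S : Prop := S 1 /\ forall A B, S A -> S B -> S (A * B).

Lemma mul_closedT : mul_closed setT. Proof. by []. Qed.

Lemma bihomog1 : bihomog 0 1.
Proof.
by move=> m; rewrite -mpolyX0 msuppX inE => /eqP ->; rewrite /bideg !mnm0E muln0.
Qed.

Lemma bihomog_exp d A k : bihomog d A -> bihomog (d *+ k) (A ^+ k).
Proof.
move=> hA; elim: k => [|k IH]; first exact: bihomog1.
by rewrite exprS mulrS; exact: (bihomogM hA IH).
Qed.

Lemma grfrac_sub S S' T T' d x :
  S `<=` S' -> T `<=` T' -> grfrac S T d x -> grfrac S' T' d x.
Proof.
move=> SS TT [d' [A [B [hA hB [/SS SA /TT TB] B0 ->]]]].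
by exists d', A, B.
Qed.

Lemma grfrac_poly S T d A :
  mul_closed T -> bihomog d A -> S A -> grfrac S T d (tofrac A).
Proof.
move=> [T1 _] hA SA; exists 0, A, 1; rewrite addr0 oner_neq0 tofrac1 divr1.
by split=> //; exact: bihomog1.
Qed.

Lemma grfracM S T d d' x y : mul_closed S -> mul_closed T ->
  grfrac S T d x -> grfrac S T d' y -> grfrac S T (d + d') (x * y).
Proof.
move=> [_ SM] [_ TM] [d1 [A [B [hA hB [SA TB] B0 ->]]]].
move=> [d2 [A' [B' [hA' hB' [SA' TB'] B0' ->]]]].
exists (d1 + d2), (A * A'), (B * B'); rewrite mulf_neq0 // !tofracM mulf_div.
split=> //; last by split; [exact: SM|exact: TM].
  by rewrite addrACA; exact: (bihomogM hA hA').
exact: (bihomogM hB hB').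
Qed.

Lemma grfracV S T d x : x != 0 -> grfrac S T d x -> grfrac T S (- d) x^-1.
Proof.
move=> x0 [d1 [A [B [hA hB [SA TB] B0 xE]]]].
have A0 : A != 0 by apply: contraNneq x0 => A0; rewrite xE A0 tofrac0 mul0r.
exists (d + d1), B, A; rewrite addKr; split=> //.
by rewrite xE invfM invrK mulrC.
Qed.

Lemma grfracD T d x y : mul_closed T ->
  grfrac setT T d x -> grfrac setT T d y -> grfrac setT T d (x + y).
Proof.
move=> [_ TM] [d1 [A [B [hA hB [_ TB] B0 ->]]]].
move=> [d2 [A' [B' [hA' hB' [_ TB'] B0' ->]]]].
exists (d1 + d2), (A * B' + A' * B), (B * B').
rewrite addf_div ?tofrac_eq0 // -!tofracM -tofracD mulf_neq0 //.
split=> //; last by split=> //; exact: TM.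
  apply: bihomogD; first by rewrite addrA; exact: (bihomogM hA hB').
  by rewrite [d1 + d2]addrC addrA; exact: (bihomogM hA' hB).
exact: (bihomogM hB hB').
Qed.

Lemma grfrac0 S T d : mul_closed T -> S 0 -> grfrac S T d 0.
Proof.
move=> Tcl S0; rewrite -(tofrac0 cox); apply: grfrac_poly => //.
by move=> m; rewrite msupp0.
Qed.

Lemma grfrac1 S T : mul_closed S -> mul_closed T -> grfrac S T 0 1.
Proof.
move=> [S1 _] Tcl; rewrite -(tofrac1 cox); apply: grfrac_poly => //.
exact: bihomog1.
Qed.

Lemma grfracX S d x (n : int) : mul_closed S -> x != 0 ->
  grfrac S S d x -> grfrac S S (d *~ n) (x ^ n).
Proof.
move=> Scl x0 Sx; have nat k : grfrac S S (d *+ k) (x ^+ k).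
  elim: k => [|k IH]; first exact: grfrac1.
  by rewrite exprS mulrS; exact: grfracM.
case: n => k; first exact: nat.
exact: (grfracV (expf_neq0 _ x0) (nat k.+1)).
Qed.

Lemma function_fieldP x : function_field e x <-> grfrac setT setT 0 x.
Proof.
split=> [[d [A [B [hA hB B0 ->]]]]|[d [A [B [hA hB _ B0 ->]]]]].
  by exists d, A, B; rewrite add0r.
by exists d, A, B; rewrite add0r in hA.
Qed.

(** * Local ring and order along a bihomogeneous prime *)

Section AtPrime.
Variables (p : cox) (d_p : int * int).
Hypotheses (pP : prime_elt p) (hp : bihomog d_p p).

Definition ndvd : set cox := [set A | ~ rdvd p A].
Local Notation locO := (grfrac setT ndvd).
Local Notation locU := (grfrac ndvd ndvd).

Lemma tofrac_prime_neq0 : tofrac p != 0.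
Proof. by rewrite tofrac_eq0; case: pP. Qed.

Lemma ndvd_closed : mul_closed ndvd.
Proof.
split; first exact: prime_elt_ndvd_unit (unitr1 _).
by move=> A B nA nB; case: pP => _ _ pM /pM[].
Qed.
Hint Resolve ndvd_closed mul_closedT : core.

Lemma ndvd_neq0 A : ndvd A -> A != 0.
Proof. by move=> nA; apply/eqP => A0; apply: nA; exists 0; rewrite mulr0. Qed.

Lemma locU_neq0 d x : locU d x -> x != 0.
Proof.
move=> [d' [A [B [_ _ [/ndvd_neq0 A0 _] B0 ->]]]].
by rewrite mulf_neq0 ?invr_eq0 ?tofrac_eq0.
Qed.

Lemma locU_locO d x : locU d x -> locO d x.
Proof. exact: grfrac_sub. Qed.

(** Cross multiplication would make [p] divide a product of two elements that it does not divide. *)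
Lemma locU_ndvd d d' x : locO d x -> ~ locU d' (tofrac p * x).
Proof.
move=> [d1 [A [B [_ _ [_ nB] B0 ->]]]] [d2 [A' [B' [_ _ [nA' nB'] B0' /eqP]]]].
rewrite mulrA -tofracM eqr_div ?tofrac_eq0 // -!tofracM tofrac_eq => /eqP pE.
by apply: (ndvd_closed.2 _ _ nA' nB); exists (A * B'); rewrite mulrA pE.
Qed.

(** In [x * x^-1 = 1] the product of the numerators equals that of the denominators, which [p] does
    not divide; hence [p] does not divide the numerator of [x]. *)
Lemma unit_in_locO x : unit_in (locO 0) x <-> locU 0 x.
Proof.
split=> [[x0 [d [A [B [hA hB [_ nB] B0 xE]]]]]|Ux].
  move=> [d' [C [D [_ _ [_ nD] D0 x'E]]]].
  exists d, A, B; split=> //; split=> // pA.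
  have /eqP : x * x^-1 = 1 by rewrite divff.
  rewrite x'E {1}xE mulf_div -!tofracM -tofrac1.
  rewrite -(divr1 (tofrac 1)) eqr_div ?oner_eq0 ?tofrac_eq0 ?mulf_neq0 //.
  rewrite tofrac1 mulr1 mul1r tofrac_eq => /eqP E.
  by apply: (ndvd_closed.2 _ _ nB nD); rewrite -E; exact: rdvd_mulr.
have x0 := locU_neq0 Ux; split=> //; first exact: locU_locO.
by apply: locU_locO; rewrite -[0]oppr0; exact: grfracV.
Qed.

(* [x], of bidegree [d], vanishes to the order [n] along [p = 0]. *)
Definition has_order d x (n : int) := locU (d - d_p *~ n) (x / tofrac p ^ n).

Lemma has_orderM d d' x y (n m : int) :
  has_order d x n -> has_order d' y m -> has_order (d + d') (x * y) (n + m).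
Proof.
move=> hx hy; have := grfracM ndvd_closed ndvd_closed hx hy.
rewrite /has_order mulf_div -(expfzDr _ _ tofrac_prime_neq0).
by rewrite (mulrzDr d_p n m) opprD addrACA.
Qed.

Lemma div_exp_neq0 x (n : int) : x != 0 -> x / tofrac p ^ n != 0.
Proof. by move=> x0; exact: (mulf_neq0 x0 (invr_neq0 (expfz_neq0 n tofrac_prime_neq0))). Qed.

Lemma has_orderV d x (n : int) : x != 0 -> has_order d x n -> has_order (- d) x^-1 (- n).
Proof.
move=> x0 hx; have := grfracV (div_exp_neq0 n x0) hx.
by rewrite /has_order invfM opprB mulrNz opprK addrC -invr_expz.
Qed.

Lemma has_order_locU d x : locU d x -> has_order d x 0.
Proof. by rewrite /has_order mulr0z subr0 expr0z divr1. Qed.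

Lemma has_orderp : has_order d_p (tofrac p) 1.
Proof.
by rewrite /has_order mulr1z subrr expr1z divff ?tofrac_prime_neq0 //; exact: grfrac1.
Qed.

Lemma has_orderX d x (n k : int) :
  x != 0 -> has_order d x n -> has_order (d *~ k) (x ^ k) (n * k).
Proof.
move=> x0 hx; have := grfracX k ndvd_closed (div_exp_neq0 n x0) hx.
by rewrite /has_order expfzMl -expfV exprz_exp mulrzBl mulrzA.
Qed.

(** If [n < m], then [x / p ^ n] is [p] times a fraction regular along [p], so it cannot be a unit
    there. *)
Lemma has_order_uniq d d' x (n m : int) : has_order d x n -> has_order d' x m -> n = m.
Proof.
wlog le_nm : d d' n m / n <= m => [hw hx hy|].
  have [le_nm|/ltW le_mn] := leP n m; first exact: hw le_nm hx hy.
  by apply/esym; exact: hw le_mn hy hx.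
move=> hx hy; apply/eqP; rewrite eq_le le_nm leNgt /=; apply/negP => lt_nm.
have [k mE] : exists k : nat, m = n + 1 + k%:Z.
  by exists `|(m - (n + 1))%R|%N; lia.
have xE : x / tofrac p ^ n = tofrac p * (tofrac (p ^+ k) * (x / tofrac p ^ m)).
  by rewrite tofracXn mE; exact: (div_exprz_split _ _ _ tofrac_prime_neq0).
have Ok : locO (d_p *+ k) (tofrac (p ^+ k)).
  exact: (grfrac_poly ndvd_closed (bihomog_exp (k := k) hp) I).
move: hx; rewrite /has_order xE; apply: locU_ndvd.
exact: (grfracM mul_closedT ndvd_closed Ok (locU_locO hy)).
Qed.

Lemma has_order_poly d A : A != 0 -> bihomog d A ->
  exists k : nat, has_order d (tofrac A) k.
Proof.
move=> A0 hA.
have [k [B [AE nB]]] := prime_multiplicity pP (factorial_mpoly A0); exists k.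
have pk0 : p ^+ k != 0 by rewrite expf_neq0 //; case: pP.
rewrite /has_order AE tofracM tofracXn exprnP mulrAC.
rewrite (divff (expfz_neq0 _ tofrac_prime_neq0)) mul1r.
apply: grfrac_poly => //; apply: bihomog_cofactor (bihomog_exp (k := k) hp) _ => //.
  exact: ndvd_neq0.
by rewrite -AE.
Qed.

End AtPrime.
End GradedFractions.

(** * Prime divisors *)

Section Charts.
Variables (F : finFieldType) (e : nat).
Local Notation cox := {mpoly F[2 + 2]}.
Local Notation fcox := {fraction cox}.
Local Notation bihomog := (@bihomog F e).
Local Notation grfrac := (@grfrac F e).
Implicit Types (A B p q : cox) (x y z : fcox) (d : int * int).

Section Chart.
Variables i j : 'I_2.
Local Notation D n m := ('X_[chart_mon i j n m] : cox).

Definition chart_monomials : set cox := [set M | exists n m, M = D n m].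
Local Notation locC := (grfrac setT chart_monomials).
Local Notation locM := (grfrac chart_monomials chart_monomials).

Lemma chart_monomials_closed : mul_closed chart_monomials.
Proof.
split; first by exists 0%N, 0%N; rewrite D00.
by move=> _ _ [n [m ->]] [n' [m' ->]]; exists (n + n')%N, (m + m')%N; rewrite DD.
Qed.
Hint Resolve chart_monomials_closed mul_closedT : core.

Lemma chart_ringE : chart_ring e i j = locC 0.
Proof.
apply/seteqP; split=> [_ [n [m [A [hA ->]]]]|_ [d [A [B [hA hD [_ [n [m DE]]] D0 ->]]]]].
  exists (bideg e (chart_mon i j n m)), A, (D n m); rewrite add0r D_neq0.
  split=> //; [exact: bihomogX|by split=> //; exists n, m].
rewrite DE in hD D0 *; exists n, m, A; split=> //.
rewrite (bihomog_inj D0 (@bihomogX F e _) hD).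
by rewrite add0r in hA.
Qed.

Lemma xvarE : 'X_(xvar i) = D 1 0.
Proof. by congr 'X_[_]; apply/mnmP => k; rewrite mnmDE !mulmnE muln1 muln0 addn0. Qed.

Lemma tvarE : 'X_(tvar j) = D 0 1.
Proof. by congr 'X_[_]; apply/mnmP => k; rewrite mnmDE !mulmnE muln0 muln1. Qed.

Lemma locM_neq0 d x : locM d x -> x != 0.
Proof.
move=> [_ [A [B [_ _ [[n [m ->]] _] B0 ->]]]].
by apply: mulf_neq0; rewrite ?invr_eq0 tofrac_eq0 ?D_neq0.
Qed.

(* The bidegrees of [X_i] and [T_j] form a basis of the group of bidegrees. *)
Lemma chart_unit d : exists c, locM d c.
Proof.
have hX : locM (bideg e U_(xvar i)) (tofrac 'X_(xvar i)).
  by apply: grfrac_poly => //; [exact: bihomogX|exists 1%N, 0%N; exact: xvarE].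
have hT : locM (bideg e U_(tvar j)) (tofrac 'X_(tvar j)).
  by apply: grfrac_poly => //; [exact: bihomogX|exists 0%N, 1%N; exact: tvarE].
(* [X_i] has bidegree [(1, - k)] and [T_j] has bidegree [(0, 1)], whence the exponents [d.1] and
   [d.2 + k * d.1]. *)
pose k := (e * U_(xvar i)%MM (xvar ord0))%N.
have dE : bideg e U_(xvar i) *~ d.1 + bideg e U_(tvar j) *~ (d.2 + k%:Z * d.1) = d.
  apply: injective_projections; rewrite raddfD !raddfMz /= !mulrzz !mnm1E.
    rewrite -!val_eqE /=; case: (i) => [[|[|//]] ?]; case: (j) => [[|[|//]] ?] /=; ring.
  rewrite /k !mnm1E -!val_eqE /=.
  case: (i) => [[|[|//]] ?]; case: (j) => [[|[|//]] ?] /=; rewrite ?muln1 ?muln0; ring.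
have cl := chart_monomials_closed.
have := grfracM cl cl (grfracX d.1 cl (locM_neq0 hX) hX)
                      (grfracX (d.2 + k%:Z * d.1) cl (locM_neq0 hT) hT).
by rewrite dE; exists (tofrac 'X_(xvar i) ^ d.1 * tofrac 'X_(tvar j) ^ (d.2 + k%:Z * d.1)).
Qed.

Lemma locM_locC d x : locM d x -> locC d x.
Proof. exact: grfrac_sub. Qed.

Lemma locMV d x : locM d x -> locM (- d) x^-1.
Proof. by move=> hx; apply: grfracV => //; exact: locM_neq0 hx. Qed.

(** For [p] of bidegree [d_p], this is the degree 0 part of the ideal generated by [p] in the
    localization of the Cox ring at [X_i T_j]. *)
Definition chart_prime (d_p : int * int) p : set fcox :=
  [set x | exists2 y, locC (- d_p) y & x = tofrac p * y].

Lemma chart_idealE v : chart_ideal e i j v = chart_prime (bideg e U_(v)) 'X_v.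
Proof.
apply/seteqP; split=> [_ [n [m [A [hA ->]]]]|_ [_ [d [A [B [hA hD [_ [n [m DE]]] D0 ->]]]] ->]].
  exists (tofrac A / tofrac (D n m)); last by rewrite tofracM mulrA.
  exists (bideg e (chart_mon i j n m)), A, (D n m); rewrite D_neq0; split=> //.
  - by apply: (@bihomogXI _ _ _ U_(v)%MM); rewrite addrA subrr add0r.
  - exact: bihomogX.
  - by split=> //; exists n, m.
rewrite DE in hD D0 *; exists n, m, A; rewrite mulrA tofracM; split=> //.
rewrite (bihomog_inj D0 (@bihomogX F e _) hD) -[d](addNKr (bideg e U_(v))).
exact: (bihomogM (@bihomogX F e _) hA).
Qed.

(** For a bihomogeneous prime [p], this means that the curve [p = 0] meets [U_ij]. *)
Definition on_chart p : Prop := ~ rdvd p 'X_(xvar i) /\ ~ rdvd p 'X_(tvar j).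

Section Prime.
Variables (p : cox) (d_p : int * int).
Hypotheses (pP : prime_elt p) (hp : bihomog d_p p) (chart_p : on_chart p).
Local Notation locO := (grfrac setT (ndvd p)).
Local Notation locU := (grfrac (ndvd p) (ndvd p)).

Let ndvd_cl := ndvd_closed pP.
Hint Resolve ndvd_cl : core.

Lemma monomial_ndvd : chart_monomials `<=` ndvd p.
Proof.
have [pX pT] := chart_p; move=> _ [n [m ->]].
have -> : D n m = 'X_(xvar i) ^+ n * 'X_(tvar j) ^+ m.
  by rewrite !mpolyXn -mpolyXD.
case: ndvd_cl => n1 nM; apply: (nM).
  by elim: n => [|n IH]; rewrite ?expr0 // exprS; exact: nM.
by elim: m => [|m IH]; rewrite ?expr0 // exprS; exact: nM.
Qed.

Lemma locC_locO d x : locC d x -> locO d x.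
Proof. exact: (grfrac_sub (fun _ h => h) monomial_ndvd). Qed.

Lemma locM_locU d x : locM d x -> locU d x.
Proof. exact: (grfrac_sub monomial_ndvd monomial_ndvd). Qed.

Let locO_p : locO d_p (tofrac p).
Proof. exact: grfrac_poly. Qed.

Let locUV d x : locU d x -> locU (- d) x^-1.
Proof. by move=> Ux; apply: grfracV => //; exact: locU_neq0 Ux. Qed.

Lemma div_prime_locO d x : locO d x -> ~ locU d x ->
  exists2 y, locO (d - d_p) y & x = tofrac p * y.
Proof.
move=> [d' [A [B [hA hB [_ nB] B0 ->]]]] nU.
have [[A' AE]|nA] := pselect (rdvd p A); last by case: nU; exists d', A, B.
exists (tofrac A' / tofrac B); last by rewrite AE tofracM mulrA.
exists d', A', B; split=> //.
have [->|A'0] := eqVneq A' 0; first by move=> m; rewrite msupp0.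
rewrite addrAC; apply: bihomog_cofactor hp _ => //; first by case: pP.
by rewrite -AE.
Qed.

(** [p] need not have bidegree 0; a Laurent monomial [c] in [X_i], [T_j] corrects this, and it is a
    unit along [p] because [p] divides neither variable. *)
Lemma uniformizer_locO :
  exists2 c, locU (- d_p) c & uniformizer (locO 0) (tofrac p * c).
Proof.
have [c /locM_locU Uc] := chart_unit (- d_p); exists c => //.
have c0 := locU_neq0 Uc; have fp0 := tofrac_prime_neq0 pP.
split; first by rewrite mulf_neq0.
- rewrite -(subrr d_p); apply: grfracM => //; exact: locU_locO.
- by move=> /(unit_in_locO e pP); exact: (locU_ndvd pP (locU_locO Uc)).
move=> x Ox nUx; have [|y Oy ->] := div_prime_locO Ox.
  by move=> /(unit_in_locO e pP).
rewrite -mulf_div divff // mul1r; move/locUV/locU_locO: Uc => Oc.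
by move: (grfracM (mul_closedT F) ndvd_cl Oy Oc); rewrite sub0r opprK addNr.
Qed.

(** As [c] is a unit along [p], powers of the uniformizer [p * c] measure the same order as powers
    of [p]. *)
Lemma val_in_locO x n : has_order e p d_p 0 x n -> val_in (locO 0) x = n.
Proof.
have [c Uc uc] := uniformizer_locO; rewrite /has_order => hx.
apply: val_inP uc _; first exact: grfrac1.
  by move=> y z hy hz; rewrite -(addr0 0); exact: grfracM.
apply/(unit_in_locO e pP).
have -> : x / (tofrac p * c) ^ n = x / tofrac p ^ n * c ^ (- n).
  by rewrite expfzMl invfM mulrA -(invr_expz c).
have -> : 0 = (0 - d_p *~ n) + (- d_p) *~ (- n).
  by rewrite mulrNz mulNrz opprK sub0r addrC subrr.
apply: grfracM => //; apply: grfracX => //; exact: locU_neq0 Uc.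
Qed.

Lemma chart_primeVunit d x : locC d x ->
  (exists2 y, locC (d - d_p) y & x = tofrac p * y) \/ locU d x.
Proof.
move=> [d' [A [B [hA hB [_ mB] B0 ->]]]].
have [[A' AE]|nA] := pselect (rdvd p A); last first.
  by right; exists d', A, B; split=> //; split=> //; exact: monomial_ndvd.
left; exists (tofrac A' / tofrac B); last by rewrite AE tofracM mulrA.
exists d', A', B; split=> //.
have [->|A'0] := eqVneq A' 0; first by move=> m; rewrite msupp0.
rewrite addrAC; apply: bihomog_cofactor hp _ => //; first by case: pP.
by rewrite -AE.
Qed.

(** A fraction [A / B] of bidegree 0 becomes a quotient of two functions on the chart once both
    terms are multiplied by a Laurent monomial [c] of the opposite bidegree. *)
Lemma localization_chart_prime :
  localization (chart_ring e i j) (chart_prime d_p p) = locO 0.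
Proof.
rewrite chart_ringE.
apply/seteqP; split=> [_ [x [y [Cx Cy nIy ->]]]|_ [d [A [B [hA hB [_ nB] B0 ->]]]]].
  rewrite -(subrr 0); apply: grfracM => //; first exact: locC_locO.
  have Uy : locU 0 y.
    have [[z Cz yE]|//] := chart_primeVunit Cy.
    by case: nIy; exists z => //; move: Cz; rewrite sub0r.
  exact/locU_locO/locUV.
have [c Mc] := chart_unit (- d); have c0 := locM_neq0 Mc.
have Cc A' : bihomog d A' -> locC 0 (tofrac A' * c).
  move=> hA'; rewrite -(subrr d); apply: grfracM => //; last exact: locM_locC.
  exact: grfrac_poly.
exists (tofrac A * c), (tofrac B * c); split.
- by apply: Cc; rewrite add0r in hA.
- exact: Cc.
- move=> [y /locC_locO Oy] BcE; apply: (locU_ndvd pP (d' := d - d) Oy).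
  rewrite -BcE; apply: grfracM => //; last exact: locM_locU.
  exact: grfrac_poly.
- by rewrite -mulf_div (divff c0) mulr1.
Qed.

(** A function on the chart outside the ideal is a unit along [p], and neither 1 nor a product of
    such units is a multiple of [p]. *)
Lemma chart_prime_prime : prime_ideal (chart_ring e i j) (chart_prime d_p p).
Proof.
rewrite chart_ringE; split.
- move=> _ [y Cy ->]; rewrite -(subrr d_p); apply: grfracM => //.
  exact: grfrac_poly.
- by exists 0; rewrite ?mulr0 //; exact: grfrac0.
- move=> _ _ [y Cy ->] [z Cz ->]; exists (y + z); last by rewrite mulrDr.
  exact: grfracD.
- move=> x _ Cx [y Cy ->]; exists (x * y); last by rewrite mulrCA.
  by rewrite -[- d_p]add0r; exact: grfracM.
- move=> [y /locC_locO Oy] E; apply: (locU_ndvd pP (d' := 0) Oy).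
  by rewrite -E; exact: grfrac1.
move=> x y Cx Cy [z /locC_locO Oz xyE].
have [[x' Cx' ->]|Ux] := chart_primeVunit Cx.
  by left; exists x' => //; move: Cx'; rewrite sub0r.
have [[y' Cy' ->]|Uy] := chart_primeVunit Cy.
  by right; exists y' => //; move: Cy'; rewrite sub0r.
case: (locU_ndvd pP (d' := 0 + 0) Oz).
by rewrite -xyE; exact: grfracM.
Qed.

End Prime.
End Chart.
End Charts.

Section FieldIdentities.
Variable K : fieldType.
Implicit Types a b c x y : K.

Lemma mulVVM a b c : a != 0 -> b != 0 -> c != 0 ->
  b * ((a * b)^-1 * c^-1) * (a * c) = 1.
Proof. by move=> a0 b0 c0; field; rewrite a0 b0 c0. Qed.

Lemma mulMM_split a b c x y : c != 0 ->
  a * x * (b * y) = c^-1 * (x * y) * (a * b * c).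
Proof. by move=> c0; field. Qed.

Lemma mul_split a c x : c != 0 -> a * x = x * c^-1 * (a * c).
Proof. by move=> c0; field. Qed.

End FieldIdentities.

(** * Height one primes of the charts *)

Section PrimeDivisors.
Variables (F : finFieldType) (e : nat).
Local Notation cox := {mpoly F[2 + 2]}.
Local Notation fcox := {fraction cox}.
Local Notation bihomog := (@bihomog F e).
Local Notation grfrac := (@grfrac F e).
Local Notation locO p := (grfrac setT (ndvd p)).
Local Notation locU p := (grfrac (ndvd p) (ndvd p)).
Implicit Types (A B p q : cox) (x y z : fcox) (d : int * int) (v : 'I_(2 + 2)).
Hint Resolve mul_closedT : core.

Lemma rdvd_X v p : rdvd 'X_v p <->
  comp_mpoly [tuple if k == v then 0 else 'X_k | k < 2 + 2] p = 0.
Proof. by split=> [[q ->]|/kill_eq0]; first exact: killXv. Qed.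

Lemma ndvd_X v u : u != v -> ~ rdvd 'X_v ('X_u : cox).
Proof.
by move=> /negbTE uv /rdvd_X/eqP; rewrite killXU uv -msize_poly_eq0 msizeX.
Qed.

(** Substituting 0 for [X_v] is a ring morphism into a domain, with the multiples of [X_v] as its
    kernel. *)
Lemma prime_X v : prime_elt ('X_v : cox).
Proof.
split; first by rewrite -msize_poly_eq0 msizeX.
  apply/negP => /unitrPr[q Xq1]; have := killXv v q.
  by rewrite Xq1 => /eqP; rewrite rmorph1 oner_eq0.
move=> p q /rdvd_X/eqP; rewrite killM mulf_eq0 => /orP[]/eqP ?.
  by left; apply/rdvd_X.
by right; apply/rdvd_X.
Qed.

(** A prime dividing both [X_1] and [X_2] would be associated to each, so one variable would divide
    the other; the same holds for [T_1] and [T_2]. *)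
Lemma on_chart_exists p : prime_elt p -> exists i j, on_chart i j p.
Proof.
move=> pP.
have other u v : u != v -> rdvd p 'X_v -> ~ rdvd p 'X_u.
  move=> uv /(rdvd_prime pP (@prime_X v)) vp pu.
  exact: (ndvd_X uv (rdvd_trans vp pu)).
have [i pi] : exists i, ~ rdvd p 'X_(xvar i).
  have [p0|] := pselect (rdvd p 'X_(xvar ord0)); last by exists ord0.
  by exists ord_max; exact: other p0.
have [j pj] : exists j, ~ rdvd p 'X_(tvar j).
  have [p0|] := pselect (rdvd p 'X_(tvar ord0)); last by exists ord0.
  by exists ord_max; exact: other p0.
by exists i, j.
Qed.

Section Chart.
Variables i j : 'I_2.
Local Notation locC := (grfrac setT (@chart_monomials F i j)).
Local Notation locM := (grfrac (@chart_monomials F i j) (@chart_monomials F i j)).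
Local Notation mon_closed := (@chart_monomials_closed F i j).

(* One of the prime factors of the numerator of [x], times a Laurent monomial
   making its bidegree 0, lies in [J]; it is not a unit of the chart ring. *)
Lemma prime_contains_chart_prime J x :
  prime_ideal (chart_ring e i j) J -> J x -> x != 0 ->
  exists p d, [/\ prime_elt p, bihomog d p, on_chart i j p &
                  chart_prime e i j d p `<=` J].
Proof.
rewrite chart_ringE => pJ Jx.
suff main A : prime_product A -> forall d c, bihomog d A -> locM (- d) c ->
    J (tofrac A * c) -> exists p d, [/\ prime_elt p, bihomog d p,
      on_chart i j p & chart_prime e i j d p `<=` J].
  have [d [A [B [hA hB [_ mB] B0 xE]]]] := prime_ideal_sub pJ Jx.
  rewrite xE mulf_eq0 negb_or tofrac_eq0 => /andP[A0 _].
  rewrite add0r in hA; apply: (main A (factorial_mpoly A0) d (tofrac B)^-1) => //.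
    by apply: grfracV; [rewrite tofrac_eq0|exact: grfrac_poly mon_closed hB mB].
  by rewrite -xE.
(* If [p] divides a monomial [M] in [X_i] and [T_j], then [p * c] is invertible in the chart ring,
   so [J] cannot contain it. This excludes units, with [M = 1], and primes dividing [X_i] or
   [T_j]. *)
have one_notin d d' p q c M : bihomog d p -> bihomog d' q -> locM (- d) c ->
    chart_monomials i j M -> bihomog (d + d') M -> M != 0 -> M = p * q -> ~ J (tofrac p * c).
  move=> hp hq Mc mM hM M0 ME Jpc; case: (prime_ideal1 pJ).
  have c0 := locM_neq0 Mc.
  have Cy : locC 0 (tofrac q * ((tofrac M)^-1 * c^-1)).
    have -> : 0 = d' + (- (d + d') + - (- d)) by ring.
    apply: grfracM => //; first exact: mon_closed.
      exact: grfrac_poly mon_closed hq I.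
    apply: locM_locC; apply: (grfracM mon_closed mon_closed).
      by apply: locMV; exact: grfrac_poly mon_closed hM mM.
    exact: locMV.
  have : tofrac M != 0 by rewrite tofrac_eq0.
  rewrite ME tofracM mulf_eq0 negb_or => /andP[p0 q0].
  rewrite -(mulVVM p0 q0 c0) -tofracM -ME.
  exact: (prime_idealMl pJ Cy Jpc).
elim=> {A Jx} [u uu|p A pP ppA IH] d c hA Mc Jc.
  exfalso; have u0 : u != 0 by apply: contraTneq uu => ->; rewrite unitr0.
  have hV : bihomog (0 - d) u^-1.
    apply: bihomog_cofactor hA _ => //; first by rewrite invr_eq0.
    by rewrite divrr //; exact: bihomog1.
  apply: (one_notin _ _ _ _ _ 1 hA hV Mc) Jc; first by case: mon_closed.
  - by rewrite sub0r subrr; exact: bihomog1.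
  - exact: oner_neq0.
  - by rewrite divrr.
have A0 := prime_product_neq0 ppA; have [p0 _ _] := pP.
have [d1 hp] := bihomog_factor (mulf_neq0 p0 A0) hA.
have hA1 := bihomog_cofactor p0 A0 hp hA.
have [c1 Mc1] := chart_unit F e i j (- d1).
have [c2 Mc2] := chart_unit F e i j (- (d - d1)).
have locC_poly d' q c' : bihomog d' q -> locM (- d') c' -> locC 0 (tofrac q * c').
  move=> hq Mc'; rewrite -(subrr d'); apply: grfracM => //; first exact: mon_closed.
    exact: grfrac_poly mon_closed hq I.
  exact: locM_locC.
(* The monomials [c1] and [c2] bring each of the two factors to bidegree 0, so that primality of [J]
   applies to them separately. *)
have : J ((tofrac p * c1) * (tofrac A * c2)).
  rewrite (mulMM_split _ _ _ _ (locM_neq0 Mc)) -tofracM.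
  apply: (prime_idealMl pJ) => //.
  have -> : 0 = - - d + (- d1 + - (d - d1)) by ring.
  apply/locM_locC/(grfracM mon_closed mon_closed); first exact: locMV.
  exact: grfracM mon_closed mon_closed Mc1 Mc2.
move=> /(prime_idealP pJ (locC_poly _ _ _ hp Mc1) (locC_poly _ _ _ hA1 Mc2)) [Jp|]; last first.
  exact: IH hA1 Mc2.
exists p, d1; split=> //.
  have notdvd M : chart_monomials i j M -> ~ rdvd p M.
    move=> mM [q ME]; have [n [m MD]] := mM.
    have M0 : M != 0 by rewrite MD D_neq0.
    have q0 : q != 0 by apply: contraNneq M0 => q0; rewrite ME q0 mulr0.
    have hM : bihomog (bideg e (chart_mon i j n m)) M by rewrite MD; exact: bihomogX.
    have hq : bihomog (bideg e (chart_mon i j n m) - d1) q.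
      by apply: bihomog_cofactor hp _ => //; rewrite -ME.
    apply: (one_notin _ _ _ _ _ M hp hq Mc1) Jp => //.
    by rewrite addrC subrK.
  split; apply: notdvd; first by exists 1%N, 0%N; exact: xvarE.
  by exists 0%N, 1%N; exact: tvarE.
move=> _ [y Cy ->]; have c10 := locM_neq0 Mc1.
(* Every element of the ideal of [p] is a multiple of [p * c1] in the chart ring. *)
rewrite (mul_split _ _ c10).
apply: (prime_idealMl pJ) => //.
have -> : 0 = - d1 + - - d1 by ring.
by apply: grfracM => //; [exact: mon_closed|apply/locM_locC/locMV].
Qed.

(** If [p] did not divide [q], then [q] times a Laurent monomial of bidegree [- d_q] would be a unit
    along [p], hence outside the ideal of [p]. *)
Lemma chart_prime_dvd p q d_p d_q : prime_elt p -> on_chart i j p ->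
  bihomog d_q q ->
  chart_prime e i j d_q q `<=` chart_prime e i j d_p p -> rdvd p q.
Proof.
move=> pP chp hq sub; apply: contrapT => npq.
have [c Mc] := chart_unit F e i j (- d_q).
have [|y Cy qcE] := sub (tofrac q * c); first by exists c => //; exact: locM_locC.
apply: (locU_ndvd pP (locC_locO pP chp Cy) (d' := d_q - d_q)).
rewrite -qcE; apply: grfracM; [exact: ndvd_closed|exact: ndvd_closed| |].
  by apply: grfrac_poly => //; exact: ndvd_closed.
exact: (locM_locU pP chp Mc).
Qed.

Lemma chart_prime_neq0 p d : prime_elt p ->
  exists2 x, chart_prime e i j d p x & x != 0.
Proof.
move=> pP; have [c Mc] := chart_unit F e i j (- d).
exists (tofrac p * c); first by exists c => //; exact: locM_locC.
by rewrite mulf_neq0 ?(locM_neq0 Mc) //; exact: tofrac_prime_neq0.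
Qed.

(** A nonzero prime [J] inside the ideal of [p] contains the ideal of some prime [q]. Then [p]
    divides [q], the two are associated, and [J] is squeezed between equal ideals. *)
Lemma chart_prime_height_one p d : prime_elt p -> bihomog d p -> on_chart i j p ->
  height_one_prime (chart_ring e i j) (chart_prime e i j d p).
Proof.
move=> pP hp chp; split.
- exact: chart_prime_prime.
- have [x px x0] := chart_prime_neq0 d pP; move=> p0; move: px x0.
  by rewrite p0 => ->; rewrite eqxx.
move=> J pJ Jp; have [[x [Jx x0]]|J0] := pselect (exists x, J x /\ x != 0).
  right; apply/seteqP; split=> //.
  have [q [d' [qP hq chq qJ]]] := prime_contains_chart_prime pJ Jx x0.
  have pq : rdvd p q.
    exact: (chart_prime_dvd pP chp hq (subset_trans qJ Jp)).
  have [r pE] := rdvd_prime pP qP pq.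
  apply: subset_trans qJ => _ [y Cy ->].
  have [p0 _ _] := pP; have [q0 _ _] := qP.
  have r0 : r != 0 by apply: contraNneq p0 => r0; rewrite pE r0 mulr0.
  exists (tofrac r * y); last by rewrite pE tofracM mulrA.
  have -> : - d' = (d - d') + - d by ring.
  apply: (grfracM _ mon_closed) => //; apply: (grfrac_poly mon_closed) => //.
  by apply: bihomog_cofactor hq _ => //; rewrite -pE.
left; apply/seteqP; split=> [x Jx|_ ->]; last exact: (prime_ideal0 pJ).
by apply: contrapT => /eqP x0; apply: J0; exists x.
Qed.

(** [I] contains the ideal of some bihomogeneous prime; this ideal is prime and nonzero, so
    minimality of [I] gives equality. *)
Lemma height_one_chart_prime I : height_one_prime (chart_ring e i j) I ->
  exists p d, [/\ prime_elt p, bihomog d p, on_chart i j p & I = chart_prime e i j d p].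
Proof.
move=> [pI I0 minI].
have [x [Ix x0]] : exists x, I x /\ x != 0.
  apply: contrapT => nx; apply: I0; apply/seteqP; split=> [x Ix|_ ->].
    by apply: contrapT => /eqP x0; apply: nx; exists x.
  exact: (prime_ideal0 pI).
have [p [d [pP hp chp pI']]] := prime_contains_chart_prime pI Ix x0.
exists p, d; split=> //; apply/esym.
have [p0|//] := minI _ (chart_prime_prime pP hp chp) pI'.
have [y py y0] := chart_prime_neq0 d pP; move: py y0.
by rewrite p0 => ->; rewrite eqxx.
Qed.

End Chart.
End PrimeDivisors.

(** * Coefficients of divisors as orders along primes of the Cox ring *)

Section Divisors.
Variables (F : finFieldType) (e : nat).
Local Notation cox := {mpoly F[2 + 2]}.
Local Notation fcox := {fraction cox}.
Local Notation bihomog := (@bihomog F e).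
Local Notation grfrac := (@grfrac F e).
Local Notation locO p := (grfrac setT (ndvd p) 0).
Local Notation order := (@has_order F e).
Implicit Types (A B p q : cox) (x y z : fcox) (d : int * int) (v : 'I_(2 + 2)).
Implicit Types (P Q : prime_divisor F e).

Lemma prime_divisorP P : exists p d,
  [/\ prime_elt p, bihomog d p & local_ring P = locO p].
Proof.
have [i [j [I [hI ->]]]] := local_ringP P.
have [p [d [pP hp chp ->]]] := height_one_chart_prime hI.
by exists p, d; split=> //; exact: localization_chart_prime.
Qed.

Lemma prime_divisor_exists p d : prime_elt p -> bihomog d p ->
  exists P, local_ring P = locO p.
Proof.
move=> pP hp; have [i [j chp]] := on_chart_exists pP.
have h1 := chart_prime_height_one pP hp chp.
have ex : exists i j I, height_one_prime (chart_ring e i j) I /\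
    locO p = localization (chart_ring e i j) I.
  by exists i, j, (chart_prime e i j d p); split=> //; rewrite (localization_chart_prime pP hp).
by exists (PrimeDivisor ex).
Qed.

Lemma local_ring_inj P Q : local_ring P = local_ring Q -> P = Q.
Proof.
case: P Q => [O OP] [O' OP'] /= OO; move: OP OP'; rewrite OO => OP OP'.
by rewrite (Prop_irrelevance OP OP').
Qed.

Lemma locO_dvd p q : rdvd p q -> rdvd q p -> locO p = locO q.
Proof.
move=> pq qp; apply/seteqP.
split=> x; apply: grfrac_sub => // A nA dA; apply: nA.
  exact: rdvd_trans pq dA.
exact: rdvd_trans qp dA.
Qed.

Lemma principal_coeffE P p d_p x n : prime_elt p -> bihomog d_p p ->
  local_ring P = locO p -> order p d_p 0 x n -> principal_coeff x P = n.
Proof.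
move=> pP hp PE hx; have [i [j chp]] := on_chart_exists pP.
by rewrite /principal_coeff PE; exact: (val_in_locO pP hp chp hx).
Qed.

(* The function [X_v y] vanishes to the order one along [Q = {X_v = 0}], but
   not along other prime divisors. *)
Lemma prime_coeff_order P p d_p Q v y (m : int) :
  prime_elt p -> bihomog d_p p -> local_ring P = locO p ->
  local_ring Q = locO 'X_v ->
  order 'X_v (bideg e U_(v)) (- bideg e U_(v)) y 0 ->
  order p d_p (- bideg e U_(v)) y m -> m <= 0 ->
  order p d_p (bideg e U_(v)) (tofrac 'X_v) (prime_coeff Q P).
Proof.
move=> pP hp PE QE yv yp m0; have vP := @prime_X F v.
have hv : bihomog (bideg e U_(v)) 'X_v by exact: bihomogX.
have ncl := ndvd_closed pP.
have [pX|npX] := pselect (rdvd p 'X_v).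
  have Xp := rdvd_prime pP vP pX.
  have -> : prime_coeff Q P = 1.
    rewrite /prime_coeff asboolT //; apply: local_ring_inj.
    by rewrite PE QE; exact: locO_dvd.
  have [s XE] := pX; have [t pE] := Xp; have [p0 _ _] := pP.
  have us : s \is a GRing.unit.
    apply/unitrPr; exists t; apply: (mulfI p0).
    by rewrite mulr1 mulrA -XE -pE.
  have s0 : s != 0 by apply: contraTneq us => ->; rewrite unitr0.
  rewrite /has_order mulr1z expr1z XE tofracM mulrAC (divff (tofrac_prime_neq0 pP)) mul1r.
  apply: (grfrac_poly ncl); last exact: prime_elt_ndvd_unit.
  by apply: bihomog_cofactor hp _ => //; rewrite -XE.
have OX : order p d_p (bideg e U_(v)) (tofrac 'X_v) 0.
  exact: (has_order_locU _ (grfrac_poly ncl hv npX)).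
suff -> : prime_coeff Q P = 0 by [].
rewrite /prime_coeff asboolF // => PQ.
have := has_orderM pP OX yp; rewrite subrr add0r => /(principal_coeffE pP hp PE).
have := has_orderM vP (has_orderp e _ vP) yv; rewrite subrr addr0.
by move=> /(principal_coeffE vP hv QE); rewrite PQ => ->; move: m0 => /[swap] <-.
Qed.

Lemma bideg_xvar i : bideg e U_(xvar i) = (1, - (e * (i == ord0))%:Z).
Proof. by rewrite /bideg !mnm1E -!val_eqE /=; case: i => [[|[|//]] ?]; rewrite sub0r. Qed.

Lemma bideg_tvar j : bideg e U_(tvar j) = (0, 1).
Proof.
by rewrite /bideg !mnm1E -!val_eqE /=; case: j => [[|[|//]] ?] /=; rewrite muln0.
Qed.

Lemma Se_order P p d_p : prime_elt p -> bihomog d_p p -> local_ring P = locO p ->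
  order p d_p (1, - e%:Z) (tofrac 'X_(xvar ord0)) (prime_coeff (Se F e) P).
Proof.
move=> pP hp PE; have [_ [j [_ pj]]] := on_chart_exists pP.
have X0 v : tofrac ('X_v : cox) != 0 by rewrite tofrac_eq0 -msize_poly_eq0 msizeX.
(* The test function $X_1 T_j^e / X_2$ has bidegree 0. Since [p] does not divide [T_j], only [X_2]
   contributes to the order of [y] along [p], which is therefore at most 0. *)
pose y : fcox := (tofrac 'X_(xvar ord_max))^-1 * tofrac 'X_(tvar j) ^ e%:Z.
have dE : - bideg e U_(xvar ord0) =
    - bideg e U_(xvar ord_max) + bideg e U_(tvar j) *~ e%:Z.
  rewrite !bideg_xvar bideg_tvar eqxx muln1 muln0.
  by apply: injective_projections; rewrite !(raddfD, raddfN, raddfMz) /= mulrzz; ring.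
have poly_order q d_q v : prime_elt q -> ~ rdvd q 'X_v ->
    order q d_q (bideg e U_(v)) (tofrac 'X_v) 0.
  move=> qP nq; apply: has_order_locU; apply: (grfrac_poly (ndvd_closed qP)) => //.
  exact: bihomogX.
have [k hk] : exists k : nat, order p d_p (bideg e U_(xvar ord_max))
    (tofrac 'X_(xvar ord_max)) k.
  by apply: has_order_poly => //; [rewrite -tofrac_eq0|exact: bihomogX].
have -> : (1, - e%:Z) = bideg e U_(xvar ord0) by rewrite bideg_xvar eqxx muln1.
apply: (@prime_coeff_order _ _ _ _ _ y (- k%:Z) pP hp PE); last by rewrite oppr_le0.
- rewrite /Se /= chart_idealE.
  rewrite (localization_chart_prime (@prime_X F (xvar ord0)) (@bihomogX F e _)) //.
  by split; apply: ndvd_X.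
- have XP := @prime_X F (xvar ord0).
  have := has_orderM XP
    (has_orderV XP (X0 _) (poly_order _ (bideg e U_(xvar ord0)) (xvar ord_max) XP _))
    (has_orderX XP e%:Z (X0 _) (poly_order _ _ (tvar j) XP _)).
  rewrite -dE oppr0 mul0r addr0; apply; exact: ndvd_X.
have := has_orderM pP (has_orderV pP (X0 _) hk)
  (has_orderX pP e%:Z (X0 _) (poly_order _ d_p _ pP pj)).
by rewrite -dE mul0r addr0.
Qed.

Lemma Fe_order P p d_p : prime_elt p -> bihomog d_p p -> local_ring P = locO p ->
  order p d_p (0, 1) (tofrac 'X_(tvar ord0)) (prime_coeff (Fe F e) P).
Proof.
move=> pP hp PE.
have X0 v : tofrac ('X_v : cox) != 0 by rewrite tofrac_eq0 -msize_poly_eq0 msizeX.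
have dE : - bideg e U_(tvar ord0) = - bideg e U_(tvar ord_max) by rewrite !bideg_tvar.
have [k hk] : exists k : nat, order p d_p (bideg e U_(tvar ord_max))
    (tofrac 'X_(tvar ord_max)) k.
  by apply: has_order_poly => //; [rewrite -tofrac_eq0|exact: bihomogX].
have XP := @prime_X F (tvar ord0).
rewrite -(bideg_tvar ord0).
(* Here the test function is $T_1 / T_2$. *)
apply: (@prime_coeff_order _ _ _ _ _ (tofrac 'X_(tvar ord_max))^-1 (- k%:Z) pP hp PE);
  last by rewrite oppr_le0.
- rewrite /Fe /= chart_idealE.
  rewrite (localization_chart_prime (@prime_X F (tvar ord0)) (@bihomogX F e _)) //.
  by split; apply: ndvd_X.
- rewrite dE -oppr0; apply: (has_orderV XP) => //; apply: has_order_locU.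
  apply: (grfrac_poly (ndvd_closed XP)); first exact: bihomogX.
  exact: ndvd_X.
by rewrite dE; exact: has_orderV.
Qed.

(* The prime factors of [B] are cancelled one by one. *)
Lemma dvd_of_order_ge0 A B d d' : prime_product B -> bihomog d B -> bihomog d' A -> A != 0 ->
  (forall p d_p, prime_elt p -> bihomog d_p p -> exists d'' n, 0 <= n /\
     order p d_p d'' (tofrac A / tofrac B) n) ->
  exists C, A = B * C.
Proof.
move=> ppB; elim: ppB A d d' => [u uu|p B' pP ppB IH] A d d' hB hA A0 ord.
  by exists (u^-1 * A); rewrite mulrA divrr // mul1r.
have B'0 := prime_product_neq0 ppB; have [p0 _ _] := pP.
have [d_p hp] := bihomog_factor (mulf_neq0 p0 B'0) hB.
have hB' := bihomog_cofactor p0 B'0 hp hB.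
have [A' AE] : rdvd p A.
  (* If [p] did not divide [A], then [A] would have order 0 along [p], whereas [A / B] times
     [p * B'] has order at least 1. *)
  apply: contrapT => npA; have [d'' [n [n0 hn]]] := ord p d_p pP hp.
  have [k hk] := has_order_poly pP hp B'0 hB'.
  have := has_orderM pP hn (has_orderM pP (has_orderp e d_p pP) hk).
  have B0 : tofrac (p * B') != 0 by rewrite tofrac_eq0 mulf_neq0.
  rewrite -tofracM (divfK B0) => hA1.
  have := has_order_uniq pP hp hA1 (has_order_locU d_p (grfrac_poly (ndvd_closed pP) hA npA)).
  lia.
have A'0 : A' != 0 by apply: contraNneq A0 => A'0; rewrite AE A'0 mulr0.
have hA' : bihomog (d' - d_p) A' by apply: bihomog_cofactor hp _ => //; rewrite -AE.
have [|C A'E] := IH A' _ _ hB' hA' A'0; last by exists C; rewrite AE A'E mulrA.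
move=> q d_q qP hq; have [d'' [n [n0 hn]]] := ord q d_q qP hq.
exists d'', n; split=> //; move: hn.
by rewrite AE !tofracM -mulf_div (divff (tofrac_prime_neq0 pP)) mul1r.
Qed.

Lemma has_order_exists p d_p d x : prime_elt p -> bihomog d_p p ->
  x != 0 -> grfrac setT setT d x -> exists n, order p d_p d x n.
Proof.
move=> pP hp x0 [d' [A [B [hA hB _ B0 xE]]]].
have A0 : A != 0 by apply: contraNneq x0 => A0; rewrite xE A0 tofrac0 mul0r.
have [k hk] := has_order_poly pP hp A0 hA.
have [l hl] := has_order_poly pP hp B0 hB.
have tB0 : tofrac B != 0 by rewrite tofrac_eq0.
exists (k%:Z + - l%:Z); rewrite xE.
by have := has_orderM pP hk (has_orderV pP tB0 hl); rewrite addrK.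
Qed.

End Divisors.

(** * The Riemann-Roch space *)

Section Lstar.
Variables (F : finFieldType) (e : nat).
Local Notation cox := {mpoly F[2 + 2]}.
Local Notation bihomog := (@bihomog F e).
Implicit Types (p : cox) (m : 'X_{1..2 + 2}).

Let big4 (R : nmodType) (E : 'I_(2 + 2) -> R) :
  \sum_i E i = E (xvar ord0) + E (xvar ord_max) + (E (tvar ord0) + E (tvar ord_max)).
Proof.
rewrite big_split_ord !big_ord_recl !big_ord0 /= !addr0.
by rewrite (_ : lift ord0 ord0 = ord_max); last exact: val_inj.
Qed.

Lemma homogT_bihomog k p : homogT k p -> bihomog (0, k) p.
Proof.
move=> hp m /hp[m0 m1 <-]; rewrite /bideg m0 m1 muln0 subr0 mdegE.
by rewrite big4 m0 m1 add0r.
Qed.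

Lemma bihomog_sum (I : Type) (r : seq I) (P : pred I) (E : I -> cox) d :
  (forall i, P i -> bihomog d (E i)) -> bihomog d (\sum_(i <- r | P i) E i).
Proof.
move=> hE; elim/big_ind: _ => //; last by move=> x y hx hy; exact: bihomogD.
by move=> m; rewrite msupp0.
Qed.

Lemma homogT_sum (r : seq 'X_{1..2 + 2}) (E : 'X_{1..2 + 2} -> cox) (P : pred 'X_{1..2 + 2}) k :
  (forall m, m \in r -> P m -> homogT k (E m)) -> homogT k (\sum_(m <- r | P m) E m).
Proof.
move=> hE; rewrite big_seq_cond; elim/big_ind: _.
- by move=> m; rewrite msupp0.
- by move=> x y hx hy m /msuppD_le; rewrite mem_cat => /orP[/hx|/hy].
by move=> m /andP[mr Pm]; exact: hE.
Qed.

Let tpart m : 'X_{1..2 + 2} :=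
  (U_(tvar ord0) *+ m (tvar ord0) + U_(tvar ord_max) *+ m (tvar ord_max))%MM.

Let monomial_split m : ('X_[m] : cox) =
  'X_(xvar ord0) ^+ m (xvar ord0) * 'X_(xvar ord_max) ^+ m (xvar ord_max) * 'X_[tpart m].
Proof.
rewrite !mpolyXn -!mpolyXD; congr 'X_[_]; apply/mnmP => k.
rewrite !mnmDE !mulmnE !mnm1E -!val_eqE /=.
case: k => [[|[|[|[|//]]]] lt4] /=; rewrite ?mul0n ?mul1n ?addn0 ?add0n;
  by congr (m _); apply: val_inj.
Qed.

Let tpart_homogT m : homogT (m (tvar ord0) + m (tvar ord_max))%N%:Z ('X_[tpart m] : cox).
Proof.
move=> m'; rewrite msuppX inE => /eqP ->.
by rewrite mdegE big4 !mnmDE !mulmnE !mnm1E -!val_eqE /= !mul0n !mul1n !addn0.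
Qed.

(** Sorting the monomials by their exponent [d] in [X_1], the bidegree condition leaves degree
    [a - d] in [X_2] and total degree [b - e * a + e * d] in the [T_j]. *)
Lemma LstarP a b p : Lstar e a b p <-> bihomog (a, b - e%:Z * a) p.
Proof.
case: a => [n|n] /=; last first.
  split=> [-> m|hp]; first by rewrite msupp0.
  (* The first component of a bidegree is a natural number, so no monomial occurs when [a] is
     negative. *)
  by apply: contrapT => /eqP/mlead_supp/hp.
split=> [[c [hc ->]]|hp].
  rewrite big_seq_cond; apply: bihomog_sum => d; rewrite mem_index_iota ltnS andbT => /= le_dn.
  have -> : (Posz n, b - e%:Z * Posz n) =
     bideg e U_(xvar ord0) *+ d + bideg e U_(xvar ord_max) *+ (n - d) +
     (0, b - e%:Z * n%:Z + e%:Z * d%:Z).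
    have pairMn (x y : int) k : (x, y) *+ k = (x * k%:Z, y * k%:Z).
      elim: k => [|k IH]; first by rewrite !mulr0.
      by rewrite mulrS IH; apply: injective_projections => /=; rewrite intS; ring.
    rewrite !bideg_xvar eqxx /= muln1 muln0 !pairMn.
    by apply: injective_projections => /=; lia.
  apply: bihomogM; last exact/homogT_bihomog/hc.
  apply: bihomogM; apply: bihomog_exp; exact: bihomogX.
(* [c d] is the coefficient of $X_1^d X_2^{n-d}$ in [p], as a polynomial in [T_1], [T_2]. *)
pose c d : cox := \sum_(m <- msupp p | m (xvar ord0) == d) p@_m *: 'X_[tpart m].
exists c; split=> [d le_dn|].
  apply: homogT_sum => m /hp [mn mk] /eqP md; have := @tpart_homogT m.
  rewrite (_ : (_ + _)%N%:Z = b - e%:Z * n%:Z + e%:Z * d%:Z).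
    by move=> h m' /msuppZ_le /h.
  by move: mk; rewrite md; lia.
rewrite {1}(mpolyE p).
(* After the exchange of sums, each monomial of [p] contributes for exactly one [d], its exponent in
   [X_1], which is at most [n]. *)
under [RHS]eq_bigr => d _ do rewrite /c big_distrr big_mkcond /=.
rewrite exchange_big /=; apply: eq_big_seq => m /hp[mn _].
rewrite -big_mkcond /= [RHS](eq_bigl (fun d => d == m (xvar ord0))); last first.
  by move=> d; rewrite eq_sym.
rewrite big_nat1_eq /= ltnS -mn leq_addr addKn -scalerAr.
by rewrite -monomial_split.
Qed.

End Lstar.

(** * Multiplication by $X_1^a T_1^b / f$ between the two spaces *)

Lemma mul_divA (K : fieldType) (x y z : K) : y != 0 -> z != 0 -> x = z / y * (x * y / z).
Proof. by move=> y0 z0; field; rewrite y0 z0. Qed.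

Theorem proposition1p4 (F : finFieldType) (e : nat) (G : divisor F e)
    (f : {fraction {mpoly F[2 + 2]}}) (a b : int) :
  function_field e f -> f != 0 ->
  (forall P : prime_divisor F e,
     G P + principal_coeff f P = a * prime_coeff (Se F e) P + b * prime_coeff (Fe F e) P) ->
  riemann_roch G =
    [set f / (tofrac 'X_(xvar ord0) ^ a * tofrac 'X_(tvar ord0) ^ b) * tofrac v
       | v in Lstar (F := F) e a b].
Proof.
move=> /function_fieldP hf f0 GE.
set X := tofrac 'X_(xvar ord0); set T := tofrac 'X_(tvar ord0).
have X0 : X != 0 by rewrite tofrac_eq0 -msize_poly_eq0 msizeX.
have T0 : T != 0 by rewrite tofrac_eq0 -msize_poly_eq0 msizeX.
set M := X ^ a * T ^ b.
have M0 : M != 0 by exact: (mulf_neq0 (expfz_neq0 a X0) (expfz_neq0 b T0)).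
pose D := (a, b - e%:Z * a).
have DE : (1, - e%:Z) *~ a + (0, 1) *~ b = D.
  by apply: injective_projections; rewrite raddfD !raddfMz /= !mulrzz; ring.
have T1 : mul_closed [set: {mpoly F[2 + 2]}] by [].
have hM : grfrac e setT setT D M.
  have hX : grfrac e setT setT (1, - e%:Z) X.
    have -> : (1, - e%:Z) = bideg e U_(xvar ord0) by rewrite bideg_xvar eqxx muln1.
    exact: (grfrac_poly T1 (@bihomogX F e _) I).
  have hT : grfrac e setT setT (0, 1) T.
    by rewrite -(bideg_tvar e ord0); exact: (grfrac_poly T1 (@bihomogX F e _) I).
  by rewrite -DE; exact: (grfracM T1 T1 (grfracX a T1 X0 hX) (grfracX b T1 T0 hT)).
have orderM p d_p P : prime_elt p -> bihomog e d_p p ->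
    local_ring P = grfrac e setT (ndvd p) 0 ->
    has_order e p d_p D M (a * prime_coeff (Se F e) P + b * prime_coeff (Fe F e) P).
  move=> pP hp PE; rewrite -DE [a * _]mulrC [b * _]mulrC.
  exact: (has_orderM pP (has_orderX pP a X0 (Se_order pP hp PE))
                        (has_orderX pP b T0 (Fe_order pP hp PE))).
apply/seteqP; split=> [h|_ [v /LstarP hv <-]].
  case=> [->|[/function_fieldP hh h0 hG]].
    exists 0; last by rewrite tofrac0 mulr0.
    by apply/LstarP => m; rewrite msupp0.
  pose w := h * M / f.
  have hw : grfrac e setT setT D w.
    have := grfracM T1 T1 (grfracM T1 T1 hh hM) (grfracV f0 hf).
    by rewrite add0r subr0.
  have w0 : w != 0 by exact: (mulf_neq0 (mulf_neq0 h0 M0) (invr_neq0 f0)).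
  have [d [A [B [hA hB _ B0 wE]]]] := hw.
  have A0 : A != 0 by apply: contraNneq w0 => A0; rewrite wE A0 tofrac0 mul0r.
  (* By [GE], the order of [w] along each [P] is that of [h] plus [G P], which is nonnegative for
     [h] in the Riemann-Roch space. *)
  have [|C AE] := dvd_of_order_ge0 (factorial_mpoly B0) hB hA A0.
    move=> p d_p pP hp; have [P PE] := prime_divisor_exists pP hp.
    have [nf ordf] := has_order_exists pP hp f0 hf.
    have [nh ordh] := has_order_exists pP hp h0 hh.
    exists (0 + D + - 0),
      (nh + (a * prime_coeff (Se F e) P + b * prime_coeff (Fe F e) P) + - nf).
    split.
      move: (hG P) (GE P).
      rewrite (principal_coeffE pP hp PE ordh) (principal_coeffE pP hp PE ordf); lia.
    rewrite -wE; exact: (has_orderM pP (has_orderM pP ordh (orderM _ _ _ pP hp PE))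
                                       (has_orderV pP f0 ordf)).
  have wC : w = tofrac C.
    have tB0 : tofrac B != 0 by rewrite tofrac_eq0.
    by rewrite wE AE tofracM mulrAC (divff tB0) mul1r.
  exists C; last by rewrite -wC; exact: (esym (mul_divA h M0 f0)).
  apply/LstarP; have C0 : C != 0 by rewrite -tofrac_eq0 -wC.
  have -> : (a, b - e%:Z * a) = (D + d) - d by rewrite addrK.
  by apply: bihomog_cofactor hB _ => //; rewrite -AE.
have [->|v0] := eqVneq v 0; first by left; rewrite tofrac0 mulr0.
have tv0 : tofrac v != 0 by rewrite tofrac_eq0.
right; split.
- apply/function_fieldP.
  have := grfracM T1 T1 (grfracM T1 T1 hf (grfracV M0 hM)) (grfrac_poly T1 hv I).
  by rewrite sub0r addNr.
- exact: (mulf_neq0 (mulf_neq0 f0 (invr_neq0 M0)) tv0).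
move=> P; have [p [d_p [pP hp PE]]] := prime_divisorP P.
have [nf ordf] := has_order_exists pP hp f0 hf.
have [k ordv] := has_order_poly pP hp v0 hv.
(* The polynomial [v] has order [k >= 0], so by [GE] the order of [f / M * v] along [P] is
   [k - G P]. *)
have := has_orderM pP (has_orderM pP ordf (has_orderV pP M0 (orderM _ _ _ pP hp PE))) ordv.
rewrite sub0r addNr => /(principal_coeffE pP hp PE) ->.
move: (GE P); rewrite (principal_coeffE pP hp PE ordf); lia.
Qed.
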